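(* Let $X$ be a complex Banach space that is finite-dimensional or a Hilbert space, $E=\ell^2(\mathbb Z,X)$, let $A\in L(E)$ be tridiagonal with matrix $[a_{i,j}]$, and suppose $\{a_{i,j}:i,j\in\mathbb Z\}\subset L(X)$ is relatively compact. Then, for every $n\in\mathbb N$ there exists a finite set $K_n\subset\mathbb Z$ such that: $$\forall k\in\mathbb Z\ \ \exists j\in K_n\ \text{ such that }\ \|A^+_{n,k}-A^+_{n,j}\|\le 1/n\ \text{ and }\ \|(A^* )^+_{n,k}-(A^* )^+_{n,j}\|\le1/n .\qquad( * )$$ Further, given such sets $K_n$, for $\varepsilon\ge0$ and $n\in\mathbb N$, $$\Gamma^{n,\mathrm{fin}}_\varepsilon(A)\subset\mathrm{Spec}_\varepsilon A\subset\Gamma^{n,\mathrm{fin}}_{\varepsilon+\varepsilon''_n+1/n}(A),$$ where $\varepsilon''_n:=2(\|\alpha\|_\infty+\|\gamma\|_\infty)\sin\frac{\pi}{2(n+1)}$, $\Gamma^{n,\mathrm{fin}}_\varepsilon(A):=\{\lambda\in\mathbb C:\mu^{\mathrm{fin}}_n(A-\lambda I)\le\varepsilon\}$ and, for $B\in L(E)$, $\mu^{\mathrm{fin}}_n(B):=\min_{k\in K_n}\min\big(\nu(B|_{E_{n,k}}),\nu(B^*|_{E_{n,k}})\big)$, so that $$\mu^{\mathrm{fin}}_n(A-\lambda I)=\min_{k\in K_n}\min\big(\nu(A^+_{n,k}-\lambda I^+_n),\nu((A^* )^+_{n,k}-\lambda I^+_n)\big),\quad\lambda\in\mathbb C.$$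 Further, for $\varepsilon\ge0$, $d_H\big(\Gamma^{n,\mathrm{fin}}_{\varepsilon+\varepsilon''_n+1/n}(A),\mathrm{Spec}_\varepsilon A\big)\to0$ as $n\to\infty$; in particular $d_H\big(\Gamma^{n,\mathrm{fin}}_{\varepsilon''_n+1/n}(A),\mathrm{Spec}\,A\big)\to0$.
   Context: $E=\ell^2(\mathbb Z,X)$ has norm $(\sum_j\|x_j\|_X^2)^{1/2}$. Tridiagonal: $(Ax)_i=\sum_ja_{i,j}x_j$ with $a_{i,j}\in L(X)$, $a_{i,j}=0$ for $|i-j|>1$; $\alpha_j:=a_{j+1,j}$, $\beta_j:=a_{j,j}$, $\gamma_j:=a_{j-1,j}$; $\|\alpha\|_\infty:=\sup_j\|\alpha_j\|$, etc. The Banach space adjoint $A^*$ acts on $E^*=\ell^2(\mathbb Z,X^* )$ with matrix $[a_{j,i}^*]$. For a tridiagonal operator $B$ with matrix $[b_{i,j}]$, $B^+_{n,k}$ denotes the $(n+2)\times n$ submatrix with rows $k,\dots,k+n+1$ and columns $k+1,\dots,k+n$; $I^+_n$ is the $(n+2)\times n$ matrix consisting of the $n\times n$ identity matrix with one zero row added on top and one at the bottom. Such matrices act from $X^n$ to $X^{n+2}$ (or with $X^*$ in place of $X$), $X^m$ having norm $(\sum_{j=1}^m\|\xi_j\|_X^2)^{1/2}$; matrix norms are the induced operator norms. $\nu(C):=\inf_{\|x\|=1}\|Cx\|$ (lower norm). $E_{n,k}$ is the subspace of sequences (in $E$, or in $E^*$ for adjoints) supported in $\{k+1,\dots,k+n\}$.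 $\mathrm{Spec}_\varepsilon B:=\{\lambda:1/\|(B-\lambda I)^{-1}\|\le\varepsilon\}$ for $\varepsilon>0$ (with $\|C^{-1}\|:=\infty$ if $C$ is not invertible, $1/\infty:=0$), $\mathrm{Spec}_0B:=\mathrm{Spec}\,B$. $d_H(S,T):=\max(\sup_{s\in S}\mathrm{dist}(s,T),\sup_{t\in T}\mathrm{dist}(t,S))$ for bounded non-empty $S,T\subset\mathbb C$. *)

(* Defs.v *)
From HB Require Import structures.
From mathcomp Require Import all_boot all_order all_algebra.
From mathcomp Require Import complex sesquilinear finmap.
From mathcomp Require Import all_classical all_reals all_analysis.
From mathcomp Require Import ring.

Set Implicit Arguments.
Unset Strict Implicit.
Unset Printing Implicit Defensive.

Import Order.TTheory GRing.Theory Num.Theory numFieldNormedType.Exports.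

Local Open Scope classical_set_scope.
Local Open Scope ring_scope.
Local Open Scope complex_scope.

(* The library norm of a complex normed space takes its values in R[i];
   nrm is the same norm as a real number (see normrE). *)
Definition nrm (R : realType) (V : normedZmodType R[i]) (x : V) : R :=
  complex.Re `|x|.

Section NormTheory.
Variable R : realType.

Lemma normrE (V : normedZmodType R[i]) (x : V) : `|x| = (nrm x)%:C.
Proof. by rewrite /nrm RRe_real// normr_real. Qed.

Lemma nrm_ge0 (V : normedZmodType R[i]) (x : V) : 0 <= nrm x.
Proof. by rewrite -ler0c -normrE normr_ge0. Qed.

Lemma nrmD (V : normedZmodType R[i]) (x y : V) : nrm (x + y) <= nrm x + nrm y.
Proof. by rewrite -lecR rmorphD/= -!normrE ler_normD. Qed.

Lemma nrmZ (V : normedModType R[i]) (c : R[i]) (x : V) :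
  nrm (c *: x) = nrm c * nrm x.
Proof.
have := normrZ c x; rewrite !normrE -rmorphM/= => /(congr1 (@complex.Re R)).
by [].
Qed.

Lemma nrm0 (V : normedZmodType R[i]) : nrm (0 : V) = 0.
Proof. by rewrite /nrm normr0. Qed.

Lemma nrm_eq0 (V : normedZmodType R[i]) (x : V) : nrm x = 0 -> x = 0.
Proof. by move=> h; apply: normr0_eq0; rewrite normrE h. Qed.

End NormTheory.

Definition opnorm (R : realType) (U V : normedZmodType R[i]) (f : U -> V)
    : \bar R :=
  ereal_sup [set (nrm (f x))%:E | x in [set x | nrm x <= 1]].

Section BoundedOperators.
Variable R : realType.
Implicit Types U V W : normedModType R[i].

Definition bounded_op U V (f : U -> V) : Prop :=
  linear f /\ exists M : R, forall x, nrm (f x) <= M * nrm x.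

Lemma bounded_op0 U V : bounded_op (0 : U -> V).
Proof.
split; first by move=> c x y /=; rewrite scaler0 addr0.
by exists 0 => x; rewrite nrm0 mul0r.
Qed.

Lemma bounded_op_comb U V (c : R[i]) (f g : U -> V) :
  bounded_op f -> bounded_op g -> bounded_op (c *: f + g).
Proof.
move=> [lf [M hM]] [lg [N hN]]; split.
  move=> d x y; rewrite !fctE lf lg !scalerDr !scalerA [c * d]mulrC.
  by rewrite addrACA.
exists (nrm c * M + N) => x; rewrite !fctE.
apply: le_trans (nrmD _ _) _; rewrite mulrDl lerD// nrmZ -mulrA.
by rewrite ler_wpM2l// nrm_ge0.
Qed.

Lemma bounded_op_id U : bounded_op (@idfun U).
Proof. by split=> //; exists 1 => x; rewrite mul1r. Qed.

Lemma bounded_op_comp U V W (g : V -> W) (f : U -> V) :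
  bounded_op f -> bounded_op g -> bounded_op (fun x => g (f x)).
Proof.
move=> [lf [M hM]] [lg [N hN]]; split; first by move=> c x y /=; rewrite lf lg.
exists (`|N| * M) => x /=; apply: le_trans (hN _) _.
apply: (@le_trans _ _ (`|N| * nrm (f x))).
  by rewrite ler_wpM2r// ?nrm_ge0// ler_norm.
by rewrite -mulrA ler_wpM2l.
Qed.

Definition bop_pred U V : {pred U -> V} := fun f => `[< bounded_op f >].

(* the bounded linear operators U -> V, that is L(U, V) *)
Record bop U V := Bop { bop_fun :> U -> V ; bop_prop : bop_fun \in @bop_pred U V }.

End BoundedOperators.

Section BopLmodule.
Variables (R : realType) (U V : normedModType R[i]).

HB.instance Definition _ := [isSub of bop U V for @bop_fun R U V].
HB.instance Definition _ := [Choice of bop U V by <:].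

Let bop_closed : submod_closed (@bop_pred R U V).
Proof.
split; first by apply/asboolP; exact: bounded_op0.
by move=> c f g /asboolP hf /asboolP hg; apply/asboolP; exact: bounded_op_comb.
Qed.
HB.instance Definition _ :=
  GRing.isSubmodClosed.Build _ _ (@bop_pred R U V) bop_closed.
HB.instance Definition _ := [SubChoice_isSubLmodule of bop U V by <:].

Lemma bopP (f : bop U V) : bounded_op f.
Proof. by case: f => f /= /asboolP. Qed.

Lemma bop_linear (f : bop U V) : linear f. Proof. by case: (bopP f). Qed.

Lemma bopE (f g : bop U V) : f =1 g -> f = g.
Proof. by move=> fg; apply: val_inj; apply/funext. Qed.

Lemma bopZ (f : bop U V) c x : f (c *: x) = c *: f x.
Proof.
have f0 : f 0 = 0.
  have /(congr1 (fun z => z - f 0)) := bop_linear f 1 0 0.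
  by rewrite !scale1r addr0 addrK subrr.
by have := bop_linear f c x 0; rewrite !addr0 f0 addr0.
Qed.

Definition bopnorm (f : bop U V) : R := fine (opnorm f).

Lemma bopnormE (f : bop U V) : opnorm f = (bopnorm f)%:E.
Proof.
have [_ [M hM]] := bopP f; rewrite /bopnorm fineK// /opnorm fin_numElt.
apply/andP; split.
  apply: (@lt_le_trans _ _ 0%E) => //; apply: ereal_sup_ge.
  exists (nrm (f 0))%:E; last by rewrite lee_fin nrm_ge0.
  by exists 0 => //=; rewrite nrm0.
apply: (@le_lt_trans _ _ (`|M|)%:E); last exact: ltry.
apply: ge_ereal_sup => _ [x /= x1 <-]; rewrite lee_fin.
apply: le_trans (hM x) _; apply: (@le_trans _ _ (`|M| * nrm x)).
  by rewrite ler_wpM2r ?nrm_ge0 ?ler_norm.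
by rewrite -[leRHS]mulr1 ler_wpM2l.
Qed.

Lemma bopnorm_ge (f : bop U V) x : nrm (f x) <= bopnorm f * nrm x.
Proof.
have [x0|x0] := eqVneq (nrm x) 0.
  have -> : x = 0 :> U by exact: nrm_eq0.
  have := bopZ f 0 0; rewrite !scale0r => ->.
  by rewrite !nrm0 mulr0.
have xp : 0 < nrm x by rewrite lt_neqAle eq_sym x0 nrm_ge0.
have e : nrm ((nrm x)^-1%:C : R[i]) = (nrm x)^-1.
  by rewrite /nrm ger0_norm// ler0c invr_ge0 nrm_ge0.
rewrite -ler_pdivrMr// mulrC -e -nrmZ -bopZ.
rewrite -lee_fin -bopnormE; apply: ereal_sup_ubound.
by exists ((nrm x)^-1%:C *: x) => //=; rewrite nrmZ e mulVf.
Qed.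

Lemma bopnorm_le (f : bop U V) (M : R) : 0 <= M ->
  (forall x, nrm (f x) <= M * nrm x) -> bopnorm f <= M.
Proof.
move=> M0 hM; rewrite -lee_fin -bopnormE; apply: ge_ereal_sup => _ [x /= x1 <-].
by rewrite lee_fin; apply: le_trans (hM x) _; rewrite -[leRHS]mulr1 ler_wpM2l.
Qed.

Lemma bopnorm_ge0 (f : bop U V) : 0 <= bopnorm f.
Proof.
rewrite -lee_fin -bopnormE; apply: ereal_sup_ge.
exists (nrm (f 0))%:E; last by rewrite lee_fin nrm_ge0.
by exists 0 => //=; rewrite nrm0.
Qed.

Let norm_D (f g : bop U V) :
  (bopnorm (f + g))%:C <= (bopnorm f)%:C + (bopnorm g)%:C.
Proof.
rewrite -rmorphD/= lecR; apply: bopnorm_le; first by rewrite addr_ge0 ?bopnorm_ge0.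
move=> x; apply: le_trans (nrmD (f x) (g x)) _.
by rewrite mulrDl lerD// bopnorm_ge.
Qed.

Let norm_Z (c : R[i]) (f : bop U V) :
  (bopnorm (c *: f))%:C = `|c| * (bopnorm f)%:C.
Proof.
have le1 (d : R[i]) (g : bop U V) : bopnorm (d *: g) <= nrm d * bopnorm g.
  apply: bopnorm_le; first by rewrite mulr_ge0 ?nrm_ge0 ?bopnorm_ge0.
  move=> x; rewrite [X in nrm X](_ : _ = d *: g x)// nrmZ -mulrA.
  by rewrite ler_wpM2l ?nrm_ge0 ?bopnorm_ge.
rewrite (normrE c) -rmorphM/=; congr (_%:C); apply/eqP; rewrite eq_le le1/=.
have [->|c0] := eqVneq c 0; first by rewrite nrm0 mul0r bopnorm_ge0.
have cn : 0 < nrm c by rewrite -ltcR -normrE normr_gt0.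
rewrite mulrC -ler_pdivlMr// mulrC.
have -> : (nrm c)^-1 = nrm c^-1.
  by apply: (@complexI R); rewrite -normrE normfV normrE fmorphV.
by have := le1 c^-1 (c *: f); rewrite scalerA mulVf// scale1r.
Qed.

Let norm_0 (f : bop U V) : (bopnorm f)%:C = 0 -> f = 0.
Proof.
move=> /(congr1 (@complex.Re R)) /= f0; apply: bopE => x; apply: nrm_eq0.
by apply/eqP; rewrite eq_le nrm_ge0 andbT; have := bopnorm_ge f x; rewrite f0 mul0r.
Qed.

(* L(U, V) with the operator norm *)
HB.instance Definition _ :=
  Lmodule_isNormed.Build R[i] (bop U V) norm_D norm_Z norm_0.

Lemma nrm_bopE (f : bop U V) : (nrm f)%:E = opnorm f.
Proof. by rewrite bopnormE. Qed.

End BopLmodule.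

Section BopConstructions.
Variable R : realType.
Implicit Types U V W : normedModType R[i].

Definition mk_bop U V (f : U -> V) (hf : bounded_op f) : bop U V :=
  Bop (asboolT hf).

Definition bop_id U : bop U U := mk_bop (bounded_op_id U).

Definition bop_comp U V W (g : bop V W) (f : bop U V) : bop U W :=
  mk_bop (bounded_op_comp (bopP f) (bopP g)).

Definition dual U : normedModType R[i] := bop U R[i]^o.

Lemma bounded_adjoint U V (B : bop U V) :
  bounded_op (fun phi : dual V => bop_comp phi B : dual U).
Proof.
split; first by move=> c f g; exact: bopE.
exists (bopnorm B) => f; apply: bopnorm_le.
  by rewrite mulr_ge0 ?bopnorm_ge0 ?nrm_ge0.
move=> x; apply: le_trans (bopnorm_ge f (B x)) _.
rewrite [leRHS]mulrAC mulrC ler_wpM2r ?bopnorm_ge0//.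
exact: bopnorm_ge.
Qed.

(* the Banach space adjoint, phi |-> phi o B *)
Definition adjoint U V (B : bop U V) : bop (dual V) (dual U) :=
  mk_bop (bounded_adjoint B).

End BopConstructions.

Section Ell2.
Variables (R : realType) (I : choiceType) (X : normedModType R[i]).
Implicit Types x y : I -> X.

Definition sqsum x : \bar R := \esum_(i in [set: I]) (nrm (x i) ^+ 2)%:E.

Lemma sqsum_ge0 x : (0 <= sqsum x)%E.
Proof. by apply: esum_ge0 => i _; rewrite lee_fin sqr_ge0. Qed.

Lemma sqsumMl (a : R) (f : I -> R) : 0 <= a -> (forall i, 0 <= f i) ->
  (\esum_(i in [set: I]) (a * f i)%:E <= a%:E * \esum_(i in [set: I]) (f i)%:E)%E.
Proof.
move=> a0 f0; apply: ge_ereal_sup => _ [A [finA _] <-].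
under eq_fsbigr do rewrite EFinM.
rewrite -ge0_mule_fsumr; last by move=> i; rewrite lee_fin.
rewrite lee_wpmul2l ?lee_fin//; apply: ereal_sup_ubound.
by exists A.
Qed.

Lemma sqsum_comb (x y : I -> X) (p q : R) : 0 <= p -> 0 <= q ->
  ((p * q)%:E * sqsum (x + y)%R <=
   ((p + q) * q)%:E * sqsum x + ((p + q) * p)%:E * sqsum y)%E.
Proof.
move=> p0 q0; have [->|pn0] := eqVneq p 0.
  by rewrite mul0r mul0e adde_ge0// mule_ge0 ?sqsum_ge0// lee_fin mulr_ge0 ?addr_ge0.
have [->|qn0] := eqVneq q 0.
  by rewrite mulr0 mul0e adde_ge0// mule_ge0 ?sqsum_ge0// lee_fin mulr_ge0 ?addr_ge0.
have pp : 0 < p by rewrite lt_neqAle eq_sym pn0.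
have qp : 0 < q by rewrite lt_neqAle eq_sym qn0.
have pqp : 0 < p * q by rewrite mulr_gt0.
have key : (sqsum (x + y)%R <= \esum_(i in [set: I]) ((p + q) / p * nrm (x i) ^+ 2)%:E
    + \esum_(i in [set: I]) ((p + q) / q * nrm (y i) ^+ 2)%:E)%E.
  rewrite -esumD; first last.
  - by move=> i _; rewrite lee_fin mulr_ge0 ?sqr_ge0// divr_ge0 ?addr_ge0.
  - by move=> i _; rewrite lee_fin mulr_ge0 ?sqr_ge0// divr_ge0 ?addr_ge0.
  apply: le_esum => i _; rewrite -EFinD lee_fin.
  apply: (@le_trans _ _ ((nrm (x i) + nrm (y i)) ^+ 2)).
    by rewrite ler_sqr ?nnegrE ?addr_ge0 ?nrm_ge0// nrmD.
  set a := nrm (x i); set b := nrm (y i).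
  rewrite -subr_ge0.
  rewrite (_ : _ - _ = (q * a - p * b) ^+ 2 / (p * q)); last by field; rewrite pn0 qn0.
  by rewrite divr_ge0 ?sqr_ge0 ?ltW.
have d0 (u : R) : 0 < u -> 0 <= (p + q) / u by move=> /ltW u0; rewrite divr_ge0 ?addr_ge0.
have key2 := le_trans key (leeD (sqsumMl (d0 _ pp) (fun i => sqr_ge0 (nrm (x i))))
                                (sqsumMl (d0 _ qp) (fun i => sqr_ge0 (nrm (y i))))).
have := @lee_wpmul2l R (p * q)%:E _ _ _ key2 => /(_ _)/wrap[]; first by rewrite lee_fin ltW.
move=> /le_trans; apply.
rewrite ge0_muleDr; [|by rewrite mule_ge0 ?sqsum_ge0// lee_fin d0..].
by rewrite !muleA -!EFinM le_eqVlt; apply/orP; left; apply/eqP;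
   congr (_%:E * _ + _%:E * _)%E; field.
Qed.

Definition in_ell2 x : Prop := (sqsum x < +oo)%E.

Lemma in_ell2_0 : in_ell2 0.
Proof.
rewrite /in_ell2 /sqsum esum1 ?ltry// => i _.
by rewrite [X in nrm X](_ : _ = 0 :> X)// nrm0 expr0n.
Qed.

Lemma in_ell2D x y : in_ell2 x -> in_ell2 y -> in_ell2 (x + y).
Proof.
rewrite /in_ell2 => hx hy.
have := @sqsum_comb x y 1 1 ler01 ler01; rewrite !mulr1 mul1e => /le_lt_trans; apply.
by rewrite lte_add_pinfty// lte_mul_pinfty// lee_fin ?addr_ge0.
Qed.

Lemma sqsumZ (c : R[i]) x : (sqsum (c *: x)%R <= (nrm c ^+ 2)%:E * sqsum x)%E.
Proof.
have := @sqsumMl (nrm c ^+ 2) (fun i => nrm (x i) ^+ 2) (sqr_ge0 _) (fun i => sqr_ge0 _).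
apply: le_trans; apply: le_esum => i _.
by rewrite [X in nrm X](_ : _ = c *: x i)// nrmZ exprMn.
Qed.

Lemma in_ell2Z (c : R[i]) x : in_ell2 x -> in_ell2 (c *: x).
Proof.
move=> hx; apply: le_lt_trans (sqsumZ c x) _.
by rewrite lte_mul_pinfty// lee_fin sqr_ge0.
Qed.

Definition ell2_pred : {pred I -> X} := fun x => `[< in_ell2 x >].

(* l^2(I, X) *)
Record ell2 := Ell2 { ell2_fun :> I -> X ; ell2_prop : ell2_fun \in ell2_pred }.

HB.instance Definition _ := [isSub of ell2 for ell2_fun].
HB.instance Definition _ := [Choice of ell2 by <:].

Let ell2_closed : submod_closed ell2_pred.
Proof.
split; first by apply/asboolP; exact: in_ell2_0.
move=> c x y /asboolP hx /asboolP hy; apply/asboolP.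
exact: in_ell2D (in_ell2Z c hx) hy.
Qed.
HB.instance Definition _ := GRing.isSubmodClosed.Build _ _ ell2_pred ell2_closed.
HB.instance Definition _ := [SubChoice_isSubLmodule of ell2 by <:].

Lemma ell2P (x : ell2) : in_ell2 x.
Proof. by case: x => x /= /asboolP. Qed.

Definition ell2norm (x : ell2) : R := Num.sqrt (fine (sqsum x)).

Lemma ell2norm_ge0 (x : ell2) : 0 <= ell2norm x.
Proof. exact: sqrtr_ge0. Qed.

Lemma sqsumE (x : ell2) : sqsum x = (ell2norm x ^+ 2)%:E.
Proof.
rewrite /ell2norm sqr_sqrtr ?fine_ge0 ?sqsum_ge0// fineK// ge0_fin_numE ?sqsum_ge0//.
exact: ell2P.
Qed.

Lemma ell2norm_eq0 (x : ell2) : ell2norm x = 0 -> x = 0.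
Proof.
move=> x0; apply: val_inj; apply/funext => i /=; apply: nrm_eq0.
apply/eqP; have : nrm (x i) ^+ 2 == 0; last by rewrite expf_eq0.
rewrite eq_le sqr_ge0 andbT -lee_fin.
have -> : 0%:E = sqsum x by rewrite sqsumE x0 expr0n.
apply: esum_ge; exists [set i]; first by split.
by rewrite fsbig_set1.
Qed.

Let norm_D (x y : ell2) :
  (ell2norm (x + y))%:C <= (ell2norm x)%:C + (ell2norm y)%:C.
Proof.
rewrite -rmorphD/= lecR.
set p := ell2norm x; set q := ell2norm y.
have [p0|p0] := eqVneq p 0.
  by rewrite (ell2norm_eq0 p0) add0r p0 add0r.
have [q0|q0] := eqVneq q 0.
  by rewrite (ell2norm_eq0 q0) addr0 q0 addr0.
have pp : 0 < p by rewrite lt_neqAle eq_sym p0 ell2norm_ge0.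
have qp : 0 < q by rewrite lt_neqAle eq_sym q0 ell2norm_ge0.
have := @sqsum_comb x y p q (ltW pp) (ltW qp).
have -> : sqsum ((x : I -> X) + (y : I -> X))%R = (ell2norm (x + y) ^+ 2)%:E.
  by rewrite -sqsumE.
rewrite !sqsumE -/p -/q.
rewrite -!EFinM -EFinD lee_fin => h.
rewrite -ler_sqr ?nnegrE ?addr_ge0 ?ell2norm_ge0//.
rewrite -(ler_pM2l (mulr_gt0 pp qp)); apply: le_trans h _.
by rewrite le_eqVlt; apply/orP; left; apply/eqP; ring.
Qed.

Let norm_Z (c : R[i]) (x : ell2) :
  (ell2norm (c *: x))%:C = `|c| * (ell2norm x)%:C.
Proof.
have le1 (d : R[i]) (y : ell2) : ell2norm (d *: y) <= nrm d * ell2norm y.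
  rewrite -ler_sqr ?nnegrE ?mulr_ge0 ?nrm_ge0 ?ell2norm_ge0//.
  rewrite -lee_fin -sqsumE exprMn EFinM -sqsumE.
  exact: sqsumZ.
rewrite (normrE c) -rmorphM/=; congr (_%:C); apply/eqP; rewrite eq_le le1/=.
have [->|c0] := eqVneq c 0; first by rewrite nrm0 mul0r ell2norm_ge0.
have cn : 0 < nrm c by rewrite -ltcR -normrE normr_gt0.
rewrite mulrC -ler_pdivlMr// mulrC.
have -> : (nrm c)^-1 = nrm c^-1.
  by apply: (@complexI R); rewrite -normrE normfV normrE fmorphV.
by have := le1 c^-1 (c *: x); rewrite scalerA mulVf// scale1r.
Qed.

Let norm_0 (x : ell2) : (ell2norm x)%:C = 0 -> x = 0.
Proof. by move=> /(congr1 (@complex.Re R)) /= /ell2norm_eq0. Qed.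

HB.instance Definition _ :=
  Lmodule_isNormed.Build R[i] ell2 norm_D norm_Z norm_0.

Lemma nrm_ell2E (x : ell2) :
  nrm x = Num.sqrt (fine (\esum_(i in [set: I]) (nrm (x i) ^+ 2)%:E)).
Proof. by []. Qed.

Definition mk_ell2 x (hx : in_ell2 x) : ell2 := Ell2 (asboolT hx).

Lemma in_ell2_single (j : I) (u : X) :
  in_ell2 (fun i => if i == j then u else 0).
Proof.
rewrite /in_ell2 /sqsum (_ : esum _ _ =
    \esum_(i in [set j]) (nrm (if i == j then u else 0) ^+ 2)%:E); last first.
  rewrite [RHS]esum_mkcond; apply: eq_esum => i _.
  have [->|ij] := eqVneq i j; first by rewrite mem_set.
  by rewrite memNset ?nrm0 ?expr0n//= => /eqP; rewrite (negbTE ij).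
by rewrite esum_set1 ?ltry// lee_fin sqr_ge0.
Qed.

Definition ell2_single (j : I) (u : X) : ell2 := mk_ell2 (in_ell2_single j u).

End Ell2.

Lemma sqsum_fin (R : realType) (m : nat) (X : normedModType R[i])
  (x : 'I_m -> X) : sqsum x = (\sum_(j < m) nrm (x j) ^+ 2)%:E.
Proof.
rewrite /sqsum esum_fset//; last first.
- by move=> j _; rewrite lee_fin sqr_ge0.
- exact: finite_finset.
rewrite (@fsbigTE _ _ _ _ [fset j in enum 'I_m]%fset); last first.
  by move=> j; rewrite !inE/= mem_enum.
rewrite -sumEFin; apply: perm_big; apply: uniq_perm.
- exact: fset_uniq.
- exact: index_enum_uniq.
- by move=> j; rewrite mem_index_enum !inE/= mem_enum.
Qed.

Lemma in_ell2_fin (R : realType) (m : nat) (X : normedModType R[i])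
  (x : 'I_m -> X) : in_ell2 x.
Proof. by rewrite /in_ell2 sqsum_fin ltry. Qed.

Lemma nrm_ell2_finE (R : realType) (m : nat) (X : normedModType R[i])
  (x : ell2 'I_m X) : nrm x = Num.sqrt (\sum_(j < m) nrm (x j) ^+ 2).
Proof. by rewrite nrm_ell2E [esum _ _]sqsum_fin. Qed.

(* the lower norm of the restriction of f to S; the infimum over the empty set
   (S without unit vectors) is +oo *)
Definition lower_norm (R : realType) (U V : normedModType R[i]) (S : set U)
    (f : U -> V) : \bar R :=
  ereal_inf [set (nrm (f x))%:E | x in S `&` [set x | nrm x = 1]].

Section Spectrum.
Variables (R : realType) (U : normedModType R[i]).
Implicit Types (B C : bop U U) (l : R[i]) (eps : R).

Definition is_inverse B C : Prop :=
  (forall x, C (B x) = x) /\ (forall x, B (C x) = x).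

Definition invertible B : Prop := exists C, is_inverse B C.

(* |B^-1|, with value +oo when B is not invertible *)
Definition inv_norm B : \bar R :=
  if pselect (invertible B) is left H then (nrm (projT1 (cid H)))%:E else +oo%E.

Definition Spec B : set R[i] := [set l | ~ invertible (B - l *: bop_id U)].

(* for extended reals, +oo^-1 = 0 and 0^-1 = +oo *)
Definition Spec_eps eps B : set R[i] :=
  if eps == 0 then Spec B
  else [set l | ((inv_norm (B - l *: bop_id U)%R)^-1 <= eps%:E)%E].

End Spectrum.

Section Hausdorff.
Variable R : realType.
Implicit Types S T : set R[i].

Definition dist (s : R[i]) T : \bar R :=
  ereal_inf [set (nrm (s - t))%:E | t in T].

Definition hausdorff S T : \bar R :=
  maxe (ereal_sup [set dist s T | s in S]) (ereal_sup [set dist t S | t in T]).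

End Hausdorff.

Definition finite_dim (R : realType) (X : normedModType R[i]) : Prop :=
  exists (m : nat) (e : 'I_m -> X), forall x : X,
    exists c : 'I_m -> R[i], x = \sum_(j < m) c j *: e j.

(* a complete such X is a Hilbert space *)
Definition hilbertian (R : realType) (X : normedModType R[i]) : Prop :=
  exists ip : {dot X for Num.conj}, forall x : X, `|x| ^+ 2 = ip x x.

Section OperatorMatrices.
Variable R : realType.

(* the action of an operator matrix, from Y^n to Y^m *)
Definition mxact (Y : normedModType R[i]) m n (M : 'M[bop Y Y]_(m, n))
    (x : ell2 'I_n Y) : ell2 'I_m Y :=
  mk_ell2 (in_ell2_fin (fun i => \sum_(j < n) M i j (x j))).

(* B^+_{n,k}, for B with matrix b *)
Definition plusmx (Y : normedModType R[i]) (b : int -> int -> bop Y Y)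
    (n : nat) (k : int) : 'M[bop Y Y]_(n.+2, n) :=
  \matrix_(r < n.+2, c < n) b (k + r%:Z) (k + 1 + c%:Z).

(* l I^+_n *)
Definition scaled_Iplus (Y : normedModType R[i]) (n : nat) (l : R[i])
    : 'M[bop Y Y]_(n.+2, n) :=
  \matrix_(r < n.+2, c < n) (if r == c.+1 :> nat then l *: bop_id Y else 0).

Variable X : normedModType R[i].
Implicit Types (A B : bop (ell2 int X) (ell2 int X)) (a : int -> int -> bop X X).
Implicit Types (n : nat) (k : int) (K : {fset int}) (eps : R).

(* A is tridiagonal with matrix a; the series sum_j a_{i,j} x_j has at most
   three nonzero terms *)
Definition tridiagonal A a : Prop :=
  (forall i j : int, 1 < `|i - j| -> a i j = 0) /\
  (forall (x : ell2 int X) (i : int),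
     A x i = \sum_(j <- [:: i - 1; i; i + 1]) a i j (x j)).

(* the matrix [a_{j,i}^*] of A^* *)
Definition adjmx a : int -> int -> bop (dual X) (dual X) :=
  fun i j => adjoint (a j i).

Definition window n k : set int := [set j | k + 1 <= j <= k + n%:Z].

Definition En n k : set (ell2 int X) :=
  [set x | forall j, ~ window n k j -> x j = 0].

(* The identification of the dual of l^2(Z, X) with l^2(Z, X^* ) maps phi to the
   sequence of its components phi_j = phi o (embedding of X at position j). *)
Definition dual_comp (phi : dual (ell2 int X)) (j : int) : X -> R[i] :=
  fun u => phi (ell2_single j u).

Definition En_dual n k : set (dual (ell2 int X)) :=
  [set phi | forall j, ~ window n k j -> forall u, dual_comp phi j u = 0].

Definition covers a n K : Prop :=
  forall k : int, exists2 j : int, j \in K &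
    (opnorm (mxact (plusmx a n k - plusmx a n j)%R) <= (n%:R^-1)%:E)%E /\
    (opnorm (mxact (plusmx (adjmx a) n k - plusmx (adjmx a) n j)%R)
       <= (n%:R^-1)%:E)%E.

Definition mu_fin n K B : \bar R :=
  \big[mine/+oo%E]_(k <- K)
    mine (lower_norm (En n k) B) (lower_norm (En_dual n k) (adjoint B)).

Definition Gamma_fin n K eps A : set R[i] :=
  [set l | (mu_fin n K (A - l *: bop_id _)%R <= eps%:E)%E].

Definition alpha_inf a : R := sup (range (fun j : int => nrm (a (j + 1) j))).
Definition gamma_inf a : R := sup (range (fun j : int => nrm (a (j - 1) j))).

Definition eps_pp a n : R :=
  2 * (alpha_inf a + gamma_inf a) * sin (pi / (2 * n.+1%:R)).

End OperatorMatrices.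

(* Main.v *)
(* Let [w_r = sin (r pi / (n+1))] for [0 <= r <= n+1]. Cutting a sequence [x] with the
   translates of [w] gives pieces supported in windows of length [n]; by Minkowski's
   inequality the squared norms of the images of the pieces under a tridiagonal [B]
   sum up to at most [(|B x| + eps''_n |x|)^2] times [\sum_r w_r ^ 2], where [eps''_n]
   accounts for the commutator of [B] with the cutting. So a common lower bound of the
   finite sections of [B] is, up to [eps''_n], a lower bound of [B]. The same holds for
   the adjoint since the dual of l^2(Z, X) is l^2(Z, X^* ), and [B] is invertible with
   an inverse of norm at most [1 / m] as soon as [m] is a lower bound of both [B] and
   its adjoint: the range is closed by completeness and dense by Hahn-Banach.
   With [g l] the best common lower bound of [A - l] and of its adjoint, [Spec_eps] is
   the sublevel set [g <= eps]. As [g] is 1-Lipschitz and tends to infinity, these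
   sets are upper semicontinuous in [eps], which gives the Hausdorff convergence,
   provided that [Spec A] is not empty. If it were, the resolvent norm would attain a
   positive maximum and, by averaging the resolvent over roots of unity, would be
   constant. *)

Require Import Defs.
From HB Require Import structures.
From mathcomp Require Import all_boot all_order all_algebra.
From mathcomp Require Import complex sesquilinear finmap.
From mathcomp Require Import all_classical all_reals all_analysis.
From mathcomp Require Import cyclic separable cyclotomic.
From mathcomp Require Import ring lra zify.

Set Implicit Arguments.
Unset Strict Implicit.
Unset Printing Implicit Defensive.

Import Order.TTheory GRing.Theory Num.Theory numFieldNormedType.Exports.

Local Open Scope classical_set_scope.
Local Open Scope ring_scope.
Local Open Scope complex_scope.

(** * Norms, bounded operators and the spaces l^2(I, X) *)

(** A lower bound of an operator alone does not give surjectivity: a functional that vanishes on the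
    range is detected only by the adjoint, so both are carried along everywhere. The weights are the
    ground state of the discrete Dirichlet Laplacian on [{1, ..., n}]: they minimise the ratio of
    the squared norm of the differences to that of the weights, with minimum [2 - 2 cos (pi / (n+1))
    = (2 sin (pi / (2 (n+1))))^2]. Each of the two off-diagonals pays the root of this ratio once,
    which gives [eps''_n]. The diagonal commutes with the cutting, so a shift by [l] costs nothing
    and the error is uniform in [l]. The summand [1 / n] pays for replacing an arbitrary window by
    its representative in [K_n]. The other inclusion costs nothing, since restricting an operator
    can only raise its lower norm. Used at the level [eps + eps''_n + 1 / n], it places [Gamma]
    between two sublevel sets of [g], so that upper semicontinuity in [eps] is all that remains.
    Non-emptiness enters because the distance to the empty set is [+oo]. *)

Section Norms.
Variable R : realType.
Implicit Types V : normedZmodType R[i].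

Lemma nrmN V (x : V) : nrm (- x) = nrm x.
Proof. by rewrite /nrm normrN. Qed.

Lemma nrm_distC V (x y : V) : nrm (x - y) = nrm (y - x).
Proof. by rewrite -nrmN opprB. Qed.

Lemma nrmB V (x y : V) : nrm (x - y) <= nrm x + nrm y.
Proof. by rewrite -(nrmN y); exact: nrmD. Qed.

Lemma nrm_subr V (x y : V) : nrm x - nrm y <= nrm (x - y).
Proof. by rewrite lerBlDr -{1}(subrK y x) nrmD. Qed.

Lemma nrm_triangle V (z x y : V) : nrm (x - y) <= nrm (x - z) + nrm (z - y).
Proof. by rewrite -{1}(subrK z x) -addrA nrmD. Qed.

Lemma nrm_sum V (I : Type) (s : seq I) (P : pred I) (F : I -> V) :
  nrm (\sum_(i <- s | P i) F i) <= \sum_(i <- s | P i) nrm (F i).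
Proof.
elim/big_ind2: _ => [|x a y b hx hy|//]; first by rewrite nrm0.
by apply: le_trans (nrmD _ _) _; rewrite lerD.
Qed.

Lemma nrm_gt0 V (x : V) : (0 < nrm x) = (x != 0).
Proof.
rewrite lt_neqAle nrm_ge0 andbT eq_sym; congr negb; apply/eqP/eqP => [/nrm_eq0//|->].
exact: nrm0.
Qed.

Lemma nrm_real (r : R) : nrm (r%:C : R[i]) = `|r|.
Proof. by rewrite /nrm normc_def/= expr0n addr0 sqrtr_sqr. Qed.

Lemma nrmM (a b : R[i]) : nrm (a * b) = nrm a * nrm b.
Proof. by apply: (@complexI R); rewrite -Defs.normrE normrM !Defs.normrE -rmorphM. Qed.

Lemma nrm1 : nrm (1 : R[i]) = 1.
Proof. by rewrite /nrm normr1. Qed.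

Lemma nrmX (a : R[i]) n : nrm (a ^+ n) = nrm a ^+ n.
Proof. by elim: n => [|n IH]; rewrite ?expr0 ?nrm1// !exprS nrmM IH. Qed.

Lemma nrmV (a : R[i]) : nrm a^-1 = (nrm a)^-1.
Proof. by apply: (@complexI R); rewrite -Defs.normrE normfV Defs.normrE fmorphV. Qed.

Lemma Re_le_nrm (z : R[i]) : `|complex.Re z| <= nrm z.
Proof.
case: z => a b; rewrite /nrm normc_def/=.
by rewrite -sqrtr_sqr ler_wsqrtr// lerDl sqr_ge0.
Qed.

Lemma Im_le_nrm (z : R[i]) : `|complex.Im z| <= nrm z.
Proof.
case: z => a b; rewrite /nrm normc_def/=.
by rewrite -sqrtr_sqr ler_wsqrtr// lerDr sqr_ge0.
Qed.

Lemma nrm_le_ReIm (z : R[i]) : nrm z <= `|complex.Re z| + `|complex.Im z|.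
Proof.
rewrite -ler_sqr ?nnegrE ?nrm_ge0 ?addr_ge0//.
case: z => a b; rewrite /nrm normc_def/= sqr_sqrtr ?addr_ge0 ?sqr_ge0//.
by rewrite sqrrD !real_normK ?num_real// [leRHS]addrAC lerDl mulrn_wge0// mulr_ge0.
Qed.

End Norms.

Section BoundedOperators.
Variable R : realType.
Implicit Types U V W : normedModType R[i].

Lemma bopD U V (f : bop U V) x y : f (x + y) = f x + f y.
Proof. by have := bop_linear f 1 x y; rewrite !scale1r. Qed.

Lemma bop0 U V (f : bop U V) : f 0 = 0.
Proof. by have := bopZ f 0 0; rewrite !scale0r. Qed.

Lemma bopN U V (f : bop U V) x : f (- x) = - f x.
Proof. by rewrite -scaleN1r bopZ scaleN1r. Qed.

Lemma bopB U V (f : bop U V) x y : f (x - y) = f x - f y.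
Proof. by rewrite bopD bopN. Qed.

Lemma bop_sum U V (f : bop U V) (I : Type) (s : seq I) (P : pred I) F :
  f (\sum_(i <- s | P i) F i) = \sum_(i <- s | P i) f (F i).
Proof.
by elim/big_rec2: _ => [|i a b _ <-]; rewrite ?bop0// bopD.
Qed.

Lemma bop_subE U V (f g : bop U V) x : (f - g) x = f x - g x.
Proof. by []. Qed.

Lemma bop_scaleE U V c (f : bop U V) x : (c *: f) x = c *: f x.
Proof. by []. Qed.

Lemma bop_zeroE U V x : (0 : bop U V) x = 0.
Proof. by []. Qed.

Lemma bop_sumE U V (I : Type) (s : seq I) (P : pred I) (F : I -> bop U V) x :
  (\sum_(i <- s | P i) F i) x = \sum_(i <- s | P i) F i x.
Proof. by elim/big_rec2: _ => // i a b _ <-. Qed.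

Lemma nrm_bop_le U V (f : bop U V) x : nrm (f x) <= nrm f * nrm x.
Proof. exact: bopnorm_ge. Qed.

Lemma nrm_bop_ub U V (f : bop U V) M :
  0 <= M -> (forall x, nrm (f x) <= M * nrm x) -> nrm f <= M.
Proof. exact: bopnorm_le. Qed.

Lemma nrm_adjoint U V (f : bop U V) : nrm (adjoint f) <= nrm f.
Proof.
apply: nrm_bop_ub (nrm_ge0 _) _ => phi; apply: nrm_bop_ub => [|x].
  by rewrite mulr_ge0 ?nrm_ge0.
apply: le_trans (nrm_bop_le phi _) _; rewrite mulrAC [leRHS]mulrC.
by rewrite ler_wpM2l ?nrm_ge0 ?nrm_bop_le.
Qed.

Lemma adjointB U V (f g : bop U V) : adjoint (f - g) = adjoint f - adjoint g.
Proof. by apply: bopE => phi; apply: bopE => x; rewrite /= bopB. Qed.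

End BoundedOperators.

Section Ell2Norm.
Variables (R : realType) (I : choiceType) (X : normedModType R[i]).

Lemma sum_seq_le_esum (F : I -> R) (s : seq I) : uniq s -> (forall i, 0 <= F i) ->
  ((\sum_(i <- s) F i)%:E <= \esum_(i in [set: I]) (F i)%:E)%E.
Proof.
move=> us F0; apply: esum_ge; exists [set` s]; first by split=> //; exact: finite_seq.
by rewrite -fsbig_seq// sumEFin.
Qed.

Lemma esum_le_sum_seq (F : I -> R) M : (forall i, 0 <= F i) ->
  (forall s, uniq s -> \sum_(i <- s) F i <= M) ->
  (\esum_(i in [set: I]) (F i)%:E <= M%:E)%E.
Proof.
move=> F0 hM; apply: ge_ereal_sup => _ [A [finA _] <-].
by rewrite fsbig_finite//= sumEFin lee_fin hM.
Qed.

Lemma ell2_sum_le (x : ell2 I X) (s : seq I) :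
  uniq s -> \sum_(i <- s) nrm (x i) ^+ 2 <= nrm x ^+ 2.
Proof.
move=> us; rewrite -lee_fin -[X in (_ <= X)%E](sqsumE x).
by apply: sum_seq_le_esum => // i; exact: sqr_ge0.
Qed.

Lemma ell2_nrm_le (x : ell2 I X) M : 0 <= M ->
  (forall s, uniq s -> \sum_(i <- s) nrm (x i) ^+ 2 <= M ^+ 2) -> nrm x <= M.
Proof.
move=> M0 hM; rewrite -ler_sqr ?nnegrE ?nrm_ge0// -lee_fin -[X in (X <= _)%E](sqsumE x).
by apply: esum_le_sum_seq => // i; exact: sqr_ge0.
Qed.

Lemma in_ell2_sum (x : I -> X) M :
  (forall s, uniq s -> \sum_(i <- s) nrm (x i) ^+ 2 <= M) -> in_ell2 x.
Proof.
move=> hM; apply: le_lt_trans (ltry M).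
by apply: esum_le_sum_seq => // i; exact: sqr_ge0.
Qed.

Lemma ell2_coord_le (x : ell2 I X) i : nrm (x i) <= nrm x.
Proof.
rewrite -ler_sqr ?nnegrE ?nrm_ge0//.
by have := @ell2_sum_le x [:: i] isT; rewrite big_seq1.
Qed.

Lemma ell2_eq (x y : ell2 I X) : (forall i, x i = y i) -> x = y.
Proof. by move=> xy; apply: val_inj; apply/funext. Qed.

Lemma ell2_addE (x y : ell2 I X) i : (x + y : ell2 I X) i = x i + y i. Proof. by []. Qed.
Lemma ell2_subE (x y : ell2 I X) i : (x - y : ell2 I X) i = x i - y i. Proof. by []. Qed.
Lemma ell2_scaleE c (x : ell2 I X) i : (c *: x : ell2 I X) i = c *: x i. Proof. by []. Qed.

Lemma ell2_sumE (J : Type) (s : seq J) (P : pred J) (F : J -> ell2 I X) i :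
  (\sum_(j <- s | P j) F j : ell2 I X) i = \sum_(j <- s | P j) F j i.
Proof. by elim/big_rec2: _ => // j a b _ <-. Qed.

Lemma ell2_singleE (j : I) (u : X) (i : I) : ell2_single j u i = if i == j then u else 0.
Proof. by []. Qed.

Lemma big_seq_pred1 (V : nmodType) (s : seq I) (j : I) (F : I -> V) :
  uniq s -> j \in s -> (forall i, i != j -> F i = 0) -> \sum_(i <- s) F i = F j.
Proof.
move=> us js F0; rewrite (bigD1_seq j)//= big1 ?addr0// => i; exact: F0.
Qed.

Lemma nrm_ell2_single (j : I) (u : X) : nrm (ell2_single j u) = nrm u.
Proof.
apply/eqP; rewrite eq_le; apply/andP; split; last first.
  by have := ell2_coord_le (ell2_single j u) j; rewrite ell2_singleE eqxx.
apply: ell2_nrm_le (nrm_ge0 _) _ => s us.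
have [js|js] := boolP (j \in s).
  rewrite (@big_seq_pred1 _ _ j)// ?ell2_singleE ?eqxx// => i ij.
  by rewrite ell2_singleE (negbTE ij) nrm0 expr0n.
rewrite big_seq big1 ?sqr_ge0// => i si; rewrite ell2_singleE.
by case: eqP => [ij|_]; [rewrite -ij si in js|rewrite nrm0 expr0n].
Qed.

Lemma ell2_singleD (j : I) (u v : X) :
  ell2_single j (u + v) = ell2_single j u + ell2_single j v.
Proof.
by apply: ell2_eq => i; rewrite ell2_addE !ell2_singleE; case: eqP => // _; rewrite addr0.
Qed.

Lemma ell2_singleZ (j : I) c (u : X) : ell2_single j (c *: u) = c *: ell2_single j u.
Proof.
by apply: ell2_eq => i; rewrite ell2_scaleE !ell2_singleE; case: eqP => // _; rewrite scaler0.
Qed.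

End Ell2Norm.

(** * Sequential completeness and its passage to l^2(I, X) *)

Section Completeness.
Variable R : realType.

(** Tolerances are real here, whereas the radii of balls in a complex normed space lie in [R[i]]. *)
Definition nrm_cauchy (V : normedModType R[i]) (u : nat -> V) :=
  forall e : R, 0 < e -> exists N, forall m n, (N <= m)%N -> (N <= n)%N ->
    nrm (u m - u n) <= e.

Definition nrm_cvg (V : normedModType R[i]) (u : nat -> V) (l : V) :=
  forall e : R, 0 < e -> exists N, forall n, (N <= n)%N -> nrm (u n - l) <= e.

Definition nrm_complete (V : normedModType R[i]) :=
  forall u : nat -> V, nrm_cauchy u -> exists l, nrm_cvg u l.

Lemma complex_gt0 (e : R[i]) : 0 < e -> exists2 r : R, 0 < r & e = r%:C.
Proof.
by case: e => a b; rewrite ltcE/= => /andP[/eqP -> a0]; exists a.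
Qed.

Lemma nrm_complete_completeNormedMod (X : completeNormedModType R[i]) :
  nrm_complete X.
Proof.
move=> u cu.
have : cauchy (u @ \oo).
  apply: cauchy_exP => e /complex_gt0[r r0 ->].
  have r20 : 0 < r / 2 by rewrite divr_gt0.
  have [N hN] := cu _ r20; exists (u N); exists N => // n /= Nn.
  rewrite -ball_normE /ball_/= Defs.normrE ltcR.
  by apply: le_lt_trans (hN _ _ (leqnn N) Nn) _; rewrite gtr_pMr// invf_lt1// ltr1n.
move=> /cauchy_cvg/cvg_ex[l /= ul]; exists l => e e0.
have eC : 0 < e%:C :> R[i] by rewrite ltcR.
move/cvgrPdist_le : ul => /(_ _ eC)[N _ hN]; exists N => n Nn.
by have := hN n Nn; rewrite /= Defs.normrE lecR nrm_distC.
Qed.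

Lemma nrm_cauchy_geometric (V : normedModType R[i]) (u : nat -> V) (c q : R) :
  0 <= c -> 0 <= q < 1 -> (forall n, nrm (u n.+1 - u n) <= c * q ^+ n) -> nrm_cauchy u.
Proof.
move=> c0 /andP[q0 q1] hu e e0.
have q1' : 0 < 1 - q by rewrite subr_gt0.
have tail n k : nrm (u (n + k)%N - u n) <= c * q ^+ n / (1 - q).
  (* The factor [1 - q ^ k] of the partial geometric sum is what makes the induction on [k]
     close. *)
  suff : nrm (u (n + k)%N - u n) <= c * q ^+ n * ((1 - q ^+ k) / (1 - q)).
    move=> /le_trans; apply; rewrite ler_wpM2l ?mulr_ge0 ?exprn_ge0//.
    by rewrite ler_pdivrMr// mulVf ?gt_eqF// lerBlDr lerDl exprn_ge0.
  elim: k => [|k IH]; first by rewrite addn0 !subrr nrm0 mul0r mulr0.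
  rewrite addnS; apply: le_trans (nrm_triangle (u (n + k)%N) _ _) _.
  apply: le_trans (lerD (hu _) IH) _.
  rewrite le_eqVlt; apply/orP; left; apply/eqP; rewrite exprD exprS; field.
  by rewrite gt_eqF.
have [N hN] : exists N, c * q ^+ N / (1 - q) <= e / 2.
  have [->|cn] := eqVneq c 0; first by exists 0%N; rewrite !mul0r divr_ge0 ?ltW.
  have cp : 0 < c by rewrite lt_neqAle eq_sym cn.
  have d0 : 0 < e / 2 * (1 - q) / c by rewrite !(divr_gt0, mulr_gt0).
  have : q ^+ n @[n --> \oo] --> 0 by apply: cvg_expr; rewrite ger0_norm.
  move=> /cvgrPdist_le/(_ _ d0)[N _ /(_ N (leqnn N))]; rewrite /= sub0r normrN.
  rewrite ger0_norm ?exprn_ge0// ler_pdivlMr// => h; exists N.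
  by rewrite ler_pdivrMr// mulrC.
have tailN n : (N <= n)%N -> nrm (u n - u N) <= e / 2.
  by move=> Nn; rewrite -(subnKC Nn); apply: le_trans (tail _ _) hN.
exists N => m n Nm Nn; apply: le_trans (nrm_triangle (u N) _ _) _.
by rewrite [leRHS]splitr lerD// ?tailN// nrm_distC tailN.
Qed.

Lemma seq_nrm_small (I : choiceType) (X : normedModType R[i]) (u : nat -> I -> X)
    (l : I -> X) (s : seq I) (e : R) : 0 < e -> (forall i, nrm_cvg (u ^~ i) (l i)) ->
  exists N, forall n, (N <= n)%N -> \sum_(i <- s) nrm (u n i - l i) ^+ 2 <= e.
Proof.
move=> + ul; elim: s e => [|i s IH] e e0.
  by exists 0%N => n _; rewrite big_nil ltW.
have e20 : 0 < e / 2 by rewrite divr_gt0.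
have [N hN] := IH _ e20.
have s0 : 0 < Num.sqrt (e / 2) by rewrite sqrtr_gt0.
have [M hM] := ul i _ s0; exists (maxn N M) => n; rewrite geq_max => /andP[Nn Mn].
rewrite big_cons [leRHS]splitr lerD ?hN//.
rewrite -[e / 2]sqr_sqrtr ?(ltW e20)//.
by rewrite ler_pXn2r ?nnegrE ?nrm_ge0 ?sqrtr_ge0// hM.
Qed.

Lemma ell2_complete (I : choiceType) (X : normedModType R[i]) :
  nrm_complete X -> nrm_complete (ell2 I X).
Proof.
move=> cX u cu.
have /choice[l ul] : forall i, exists li, nrm_cvg (fun n => u n i) li.
  move=> i; apply: cX => e /cu[N hN]; exists N => m n Nm Nn.
  by apply: le_trans (hN _ _ Nm Nn); rewrite -ell2_subE ell2_coord_le.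
have bnd e : 0 < e -> exists N, forall n, (N <= n)%N -> forall s, uniq s ->
    \sum_(i <- s) nrm (u n i - l i) ^+ 2 <= e ^+ 2.
  move=> e0; have e20 : 0 < e / 2 by rewrite divr_gt0.
  have [N hN] := cu _ e20; exists N => n Nn s us.
  have e40 : 0 < (e / 2) ^+ 2 by rewrite exprn_gt0.
  have [M hM] := seq_nrm_small s e40 ul.
  (* The auxiliary index [m] may depend on the finite set [s]; the resulting bound does not. *)
  pose m := maxn N M.
  have h1 : \sum_(i <- s) nrm (u n i - u m i) ^+ 2 <= (e / 2) ^+ 2.
    apply: le_trans (ell2_sum_le (u n - u m) us) _.
    by rewrite ler_sqr ?nnegrE ?nrm_ge0 ?(ltW e20)// hN// leq_maxl.
  have h2 := hM m (leq_maxr _ _).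
  apply: (@le_trans _ _ (\sum_(i <- s) (2 * nrm (u n i - u m i) ^+ 2
                                    + 2 * nrm (u m i - l i) ^+ 2))).
    apply: ler_sum => i _.
    apply: (@le_trans _ _ ((nrm (u n i - u m i) + nrm (u m i - l i)) ^+ 2)).
      by rewrite ler_sqr ?nnegrE ?addr_ge0 ?nrm_ge0// nrm_triangle.
    by rewrite -subr_ge0 (_ : _ - _ = (nrm (u n i - u m i) - nrm (u m i - l i)) ^+ 2);
      [exact: sqr_ge0|ring].
  rewrite big_split/= -!mulr_sumr.
  by apply: le_trans (lerD (ler_wpM2l _ h1) (ler_wpM2l _ h2)) _ => //; lra.
have [N hN] := bnd 1 ltr01.
have l2l : in_ell2 l.
  (* The coordinatewise limit [l] differs from [u N] by a square summable sequence, by the uniform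
     bound with tolerance 1. *)
  have h : in_ell2 (fun i => u N i - l i) by apply: (in_ell2_sum (hN N (leqnn N))).
  have -> : l = (u N : I -> X) + (-1) *: (fun i => u N i - l i).
    apply/funext => i; rewrite [RHS](_ : _ = u N i + (-1) *: (u N i - l i))//.
    by rewrite scaleN1r opprB addrC subrK.
  by apply: in_ell2D; [exact: ell2P|exact: in_ell2Z].
exists (mk_ell2 l2l) => e e0; have [M hM] := bnd _ e0.
by exists M => n Mn; apply: ell2_nrm_le (ltW e0) _ => s us; exact: hM.
Qed.

End Completeness.

(** * Bounded below operators and the Hahn-Banach theorem *)

Section BoundedBelow.
Variable R : realType.

(** A nonpositive [m] is allowed and makes the condition trivial, so that perturbation estimates may
    subtract from [m] without side conditions. *)
Definition bounded_below (U V : normedModType R[i]) (m : R) (f : U -> V) :=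
  forall x, m * nrm x <= nrm (f x).

(* The iteration of the open mapping theorem: the residuals [y - T (s n)] decay
   geometrically, so the approximate solutions [s n] converge. *)
Lemma approx_surjective (U V : normedModType R[i]) (T : bop U V) (c q : R) :
  nrm_complete U -> 0 <= c -> 0 <= q < 1 ->
  (forall y, exists x, nrm (y - T x) <= q * nrm y /\ nrm x <= c * nrm y) ->
  forall y, exists x, T x = y.
Proof.
move=> cU c0 q01 /choice[f hf] y.
have q0 : 0 <= q by case/andP: q01.
pose s := fix s n := if n is n'.+1 then s n' + f (y - T (s n')) else 0.
have res n : nrm (y - T (s n)) <= q ^+ n * nrm y.
  elim: n => [|n IH] /=; first by rewrite bop0 subr0 mul1r.
  rewrite bopD opprD addrA; apply: le_trans (hf _).1 _.
  by rewrite exprS -mulrA ler_wpM2l.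
have cs : nrm_cauchy s.
  apply: (@nrm_cauchy_geometric _ _ _ (c * nrm y) q) => //.
    by rewrite mulr_ge0 ?nrm_ge0.
  move=> n /=; rewrite addrC addKr; apply: le_trans (hf _).2 _.
  by rewrite -mulrA ler_wpM2l// mulrC.
have [x sx] := cU _ cs; exists x; apply/eqP; rewrite eq_sym -subr_eq0; apply/eqP.
apply: nrm_eq0; apply/eqP; rewrite eq_le nrm_ge0 andbT.
apply/ler_addgt0Pr => e e0; rewrite add0r.
have e20 : 0 < e / 2 by rewrite divr_gt0.
have k0 : 0 < nrm y + 1 by rewrite ltr_wpDl ?nrm_ge0.
have t0 : 0 < nrm T + 1 by rewrite ltr_wpDl ?nrm_ge0.
have [N hN] := sx _ (divr_gt0 e20 t0).
have : q ^+ n @[n --> \oo] --> 0.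
  by apply: cvg_expr; rewrite ger0_norm//; case/andP: q01.
move=> /cvgrPdist_le/(_ _ (divr_gt0 e20 k0))[M _ hM].
pose n := maxn N M.
have := hM n (leq_maxr _ _); rewrite /= sub0r normrN ger0_norm ?exprn_ge0// => qn.
apply: le_trans (nrm_triangle (T (s n)) _ _) _; rewrite [leRHS]splitr lerD//.
  apply: le_trans (res n) _; move: qn; rewrite ler_pdivlMr// => /(le_trans _); apply.
  by rewrite ler_wpM2l ?exprn_ge0// lerDl.
rewrite -bopB; apply: le_trans (nrm_bop_le _ _) _.
have := hN n (leq_maxl _ _); rewrite ler_pdivlMr// mulrC => /(le_trans _); apply.
by rewrite ler_wpM2r ?nrm_ge0// lerDl.
Qed.

Lemma bounded_below_invertible (U : normedModType R[i]) (T : bop U U) m :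
  0 < m -> bounded_below m T -> (forall y, exists x, T x = y) ->
  exists2 C, is_inverse T C & nrm C <= m^-1.
Proof.
move=> m0 hT /choice[g hg].
have injT x y : T x = T y -> x = y.
  move=> xy; apply/eqP; rewrite -subr_eq0; apply/eqP/nrm_eq0/eqP.
  have := hT (x - y); rewrite bopB xy subrr nrm0 pmulr_rle0// => h.
  by rewrite eq_le h nrm_ge0.
have gb y : nrm (g y) <= m^-1 * nrm y by rewrite ler_pdivlMl// -{2}(hg y).
have bg : bounded_op g.
  split; last by exists m^-1.
  by move=> c x y; apply: injT; rewrite bop_linear !hg.
exists (mk_bop bg); first by split=> x //=; apply: injT; rewrite hg.
by apply: nrm_bop_ub => //; rewrite invr_ge0 ltW.
Qed.

(** For the adjoint, [phi] is recovered as [adjoint T phi] composed with [C]. The hypothesis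
    [m * nrm C <= 1], in place of [m = (nrm C)^-1], also covers an inverse of norm 0. *)
Lemma inverse_bounded_below (U : normedModType R[i]) (T C : bop U U) m :
  is_inverse T C -> 0 <= m -> m * nrm C <= 1 ->
  bounded_below m T /\ bounded_below m (adjoint T).
Proof.
move=> [CT TC] m0 mC; split=> [x|phi].
  rewrite -{1}(CT x); apply: le_trans (ler_wpM2l m0 (nrm_bop_le _ _)) _.
  by rewrite mulrA -[leRHS]mul1r ler_wpM2r ?nrm_ge0.
apply: (@le_trans _ _ (m * (nrm C * nrm (adjoint T phi)))); last first.
  by rewrite mulrA -[leRHS]mul1r ler_wpM2r ?nrm_ge0.
rewrite ler_wpM2l//; apply: nrm_bop_ub => [|x]; first by rewrite mulr_ge0 ?nrm_ge0.
rewrite -{1}(TC x); apply: le_trans (nrm_bop_le (adjoint T phi) _) _.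
by rewrite mulrAC [leRHS]mulrC ler_wpM2l ?nrm_ge0 ?nrm_bop_le.
Qed.

End BoundedBelow.

Section HahnBanach.
Variables (R : realType) (V : lmodType R[i]).
Implicit Types (p q : V -> R) (x y a : V).

Definition sublinear q :=
  (forall x y, q (x + y) <= q x + q y) /\
  (forall (t : R) x, 0 <= t -> q (t%:C *: x) <= t * q x).

Lemma sublinear0 q : sublinear q -> q 0 = 0.
Proof.
move=> [qD qZ]; apply/eqP; rewrite eq_le; apply/andP; split.
  by have := qZ 0 0 (lexx _); rewrite scaler0 mul0r.
by have := qD 0 0; rewrite addr0 lerDl.
Qed.

Lemma sublinear_ge q x : sublinear q -> - q (- x) <= q x.
Proof.
move=> sq; rewrite lerNl -subr_ge0 opprK addrC -(sublinear0 sq) -(subrr x).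
exact: sq.1.
Qed.

Lemma sublinear_homog q (t : R) x : sublinear q -> 0 <= t -> q (t%:C *: x) = t * q x.
Proof.
move=> sq; rewrite le_eqVlt => /predU1P[<-|t0].
  by rewrite scale0r sublinear0// mul0r.
apply/eqP; rewrite eq_le sq.2 ?(ltW t0)//=.
have tV : 0 <= t^-1 by rewrite invr_ge0 ltW.
have := sq.2 t^-1 (t%:C *: x) tV.
rewrite scalerA -rmorphM/= mulVf ?gt_eqF// scale1r => h.
by rewrite -ler_pdivlMl.
Qed.

(** A sublinear functional below [q] whose value at [- a] is at most [- q a]. It serves twice: it
    forces a minimal functional to be odd, and it prescribes the value at a point when
    separating. *)
Definition tilt q a x := inf [set q (x + t%:C *: a) - t * q a | t in [set t | 0 <= t]].

Lemma tilt_lb q a x : sublinear q ->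
  lbound [set q (x + t%:C *: a) - t * q a | t in [set t | 0 <= t]] (- q (- x)).
Proof.
move=> sq _ [t /= t0 <-]; rewrite lerBrDr addrC -lerBrDr opprK -sublinear_homog//.
by apply: le_trans (sq.1 _ _); rewrite addrAC subrr add0r.
Qed.

Lemma tilt_le q a x t : sublinear q -> 0 <= t ->
  tilt q a x <= q (x + t%:C *: a) - t * q a.
Proof.
move=> sq t0; apply: ge_inf; first by exists (- q (- x)); exact: tilt_lb.
by exists t.
Qed.

Lemma tilt_ge q a x b : (forall t, 0 <= t -> b <= q (x + t%:C *: a) - t * q a) ->
  b <= tilt q a x.
Proof.
move=> hb; apply: lb_le_inf.
  by exists (q (x + 0%:C *: a) - 0 * q a); exists 0 => //=.
by move=> _ [t /= t0 <-]; exact: hb.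
Qed.

Lemma tilt_sublinear q a : sublinear q -> sublinear (tilt q a).
Proof.
move=> sq; split=> [x y|t x t0].
  rewrite -lerBlDr; apply: tilt_ge => t t0; rewrite lerBlDr [leRHS]addrC -lerBlDr.
  apply: tilt_ge => s s0; rewrite lerBlDr.
  apply: (le_trans (tilt_le _ _ _ (addr_ge0 t0 s0))) => //.
  rewrite rmorphD/= scalerDl addrACA.
  by have := sq.1 (x + t%:C *: a) (y + s%:C *: a); lra.
move: t0; rewrite le_eqVlt => /predU1P[<-|t0].
  rewrite scale0r mul0r; apply: le_trans (tilt_le _ _ sq (lexx 0)) _.
  by rewrite scale0r addr0 mul0r subr0 sublinear0.
rewrite -ler_pdivrMl//; apply: tilt_ge => s s0; rewrite ler_pdivrMl//.
apply: le_trans (tilt_le _ _ sq (mulr_ge0 (ltW t0) s0)) _.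
rewrite rmorphM/= -scalerA -scalerDr sublinear_homog ?(ltW t0)//.
by rewrite mulrBr mulrA.
Qed.

Lemma tilt_le_self q a x : sublinear q -> tilt q a x <= q x.
Proof.
by move=> sq; apply: le_trans (tilt_le _ _ sq (lexx 0)) _; rewrite scale0r addr0 mul0r subr0.
Qed.

Lemma tilt_opp q a : sublinear q -> tilt q a (- a) <= - q a.
Proof.
move=> sq; apply: le_trans (tilt_le _ _ sq ler01) _.
by rewrite scale1r addNr sublinear0// mul1r sub0r.
Qed.

Lemma minimal_sublinear p : sublinear p -> exists q, [/\ sublinear q,
  forall x, q x <= p x &
  forall r, sublinear r -> (forall x, r x <= q x) -> r = q].
Proof.
move=> sp; pose S := {q : V -> R | sublinear q /\ forall x, q x <= p x}.
(* The order is reversed, so that the maximal elements given by Zorn's lemma are minimal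
   functionals. *)
pose le (s t : S) := `[< forall x, sval t x <= sval s x >].
have [||||q hq] := @Zorn S le.
- by move=> t; apply/asboolP.
- move=> r s t /asboolP rs /asboolP st; apply/asboolP => x.
  exact: le_trans (st x) (rs x).
- move=> [s hs] [t ht] /asboolP/= st /asboolP/= ts; apply: eq_exist; apply/funext => x.
  by apply/eqP; rewrite eq_le ts st.
- move=> A tA; have [[q0 Aq0]|A0] := pselect (exists q : S, A q); last first.
    by exists (exist _ p (conj sp (fun x => lexx _))) => s As; case: A0; exists s.
  pose F x := [set sval q x | q in A].
  have Flb x : lbound (F x) (- p (- x)).
    move=> _ [[q [sq qp]] Aq <-] /=.
    by apply: le_trans (sublinear_ge x sq); rewrite lerN2.
  have infle x (q : S) : A q -> inf (F x) <= sval q x.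
    by move=> Aq; apply: ge_inf; [exists (- p (- x))|exists q].
  have infge x b : (forall q : S, A q -> b <= sval q x) -> b <= inf (F x).
    move=> hb; apply: lb_le_inf; first by exists (sval q0 x), q0.
    by move=> _ [q Aq <-]; exact: hb.
  have sinf : sublinear (fun x => inf (F x)).
    split=> [x y|t x t0].
      rewrite -lerBlDr; apply: (infge) => q Aq; rewrite lerBlDr [leRHS]addrC -lerBlDr.
      apply: (infge) => r Ar; rewrite lerBlDr [leRHS]addrC.
      (* Subadditivity survives the infimum because, of two members of a chain, the smaller one can
         be used at both points. *)
      have [/asboolP qr|/asboolP rq] := tA q r Aq Ar.
        apply: le_trans (infle _ r Ar) _; apply: le_trans ((svalP r).1.1 _ _) _.
        by rewrite lerD2r.
      apply: le_trans (infle _ q Aq) _; apply: le_trans ((svalP q).1.1 _ _) _.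
      by rewrite lerD2l.
    move: t0; rewrite le_eqVlt => /predU1P[<-|t0].
      rewrite scale0r mul0r; apply: le_trans (infle _ _ Aq0) _.
      by rewrite (sublinear0 (svalP q0).1).
    rewrite -ler_pdivrMl//; apply: (infge) => q Aq; rewrite ler_pdivrMl//.
    by apply: le_trans (infle _ _ Aq) _; apply: (svalP q).1.2; exact: ltW.
  have infp x : inf (F x) <= p x by apply: le_trans (infle _ _ Aq0) _; exact: (svalP q0).2.
  pose m : S := exist _ (fun x => inf (F x)) (conj sinf infp).
  by exists m => s As; apply/asboolP => x /=; exact: infle.
exists (sval q); split=> [||r sr rq]; [exact: (svalP q).1|exact: (svalP q).2|].
have rp x : r x <= p x by apply: le_trans (rq x) _; exact: (svalP q).2.
have /(congr1 sval)//= := hq (exist _ r (conj sr rp)) (asboolT rq).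
Qed.

(* A minimal sublinear functional is linear, as tilting cannot lower it. *)
Lemma linear_minorant p : sublinear p -> exists q, [/\ forall x, q x <= p x,
  forall x y, q (x + y) = q x + q y & forall (t : R) x, q (t%:C *: x) = t * q x].
Proof.
move=> /minimal_sublinear[q [sq qp qmin]]; exists q.
have qN a : q (- a) = - q a.
  apply/eqP; rewrite eq_le; apply/andP; split.
    have <- := qmin _ (tilt_sublinear a sq) (fun x => tilt_le_self a x sq).
    apply: le_trans (tilt_opp a sq) _.
    by rewrite lerN2; exact: tilt_le_self.
  by have := sublinear_ge (- a) sq; rewrite opprK.
split=> // [x y|t x].
  apply/eqP; rewrite eq_le sq.1/= -lerBrDr -qN.
  by apply: le_trans (sq.1 _ _); rewrite addrK.
have [t0|t0] := leP 0 t; first exact: sublinear_homog.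
rewrite -[t]opprK rmorphN/= scaleNr qN sublinear_homog//; first by rewrite !mulNr.
by rewrite oppr_ge0 ltW.
Qed.

End HahnBanach.

Section Separation.
Variable R : realType.
Implicit Types U V : normedModType R[i].

(** For a real linear [q], the unique complex linear functional with real part [q]. *)
Definition complexification (V : lmodType R[i]) (q : V -> R) (x : V) : R[i] :=
  q x +i* - q ('i *: x).

Lemma complexification_bounded V (q : V -> R) :
  (forall x, q x <= nrm x) -> (forall x y, q (x + y) = q x + q y) ->
  (forall (t : R) x, q (t%:C *: x) = t * q x) ->
  bounded_op (complexification q : V -> R[i]^o).
Proof.
move=> qn qD qZ.
have qN x : q (- x) = - q x by rewrite -scaleN1r (_ : -1 = (-1 : R)%:C) ?qZ ?mulN1r// rmorphN1.
split; last first.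
  (* Bounding real and imaginary parts separately gives the constant 2; only membership in the dual
     is at stake. *)
  exists 2 => x; apply: le_trans (nrm_le_ReIm _) _ => /=.
  have qabs y : `|q y| <= nrm y by rewrite ler_norml qn andbT lerNl -qN -nrmN qn.
  rewrite normrN mulr_natl mulr2n lerD//; apply: le_trans (qabs _) _.
  by rewrite nrmZ (_ : nrm ('i : R[i]) = 1) ?mul1r// /nrm normc_def/= expr0n expr1n add0r sqrtr1.
move=> [a b] x y.
have cE : (a +i* b)%C = a%:C + b%:C * 'i by simpc.
have e1 : q ((a +i* b)%C *: x + y) = a * q x + b * q ('i *: x) + q y.
  by rewrite qD cE scalerDl qD -scalerA !qZ.
have e2 : q ('i *: ((a +i* b)%C *: x + y)) = a * q ('i *: x) - b * q x + q ('i *: y).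
  rewrite scalerDr qD scalerA (_ : 'i * (a +i* b)%C = a%:C * 'i - b%:C); last by simpc.
  by rewrite scalerBl qD qN -scalerA !qZ.
rewrite /complexification e1 e2 /GRing.scale/=; simpc.
by congr (_ +i* _); ring.
Qed.

(** The distance [p] to the range of [T] is sublinear and vanishes on the range, hence so does every
    linear minorant of [p]. Taking a minorant [q] of [tilt p y] forces in addition
    [q y >= p y >= d]; this replaces the extension of a functional from a subspace. *)
Lemma separating_functional U V (T : bop U V) (y : V) (d : R) :
  0 < d -> (forall x, d <= nrm (y - T x)) ->
  exists2 phi : dual V, phi != 0 & adjoint T phi = 0.
Proof.
move=> d0 hd; pose p (x : V) := inf (range (fun u => nrm (x - T u))).
have ple x u : p x <= nrm (x - T u).
  by apply: ge_inf; [exists 0 => _ [? _ <-]; exact: nrm_ge0|exists u].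
have pge x b : (forall u, b <= nrm (x - T u)) -> b <= p x.
  move=> hb; apply: lb_le_inf; first by exists (nrm (x - T 0)), 0.
  by move=> _ [u _ <-].
have pn x : p x <= nrm x by have := ple x 0; rewrite bop0 subr0.
have sp : sublinear p.
  split=> [x z|t x].
    rewrite -lerBlDr; apply: (pge) => u; rewrite lerBlDr [leRHS]addrC -lerBlDr.
    apply: (pge) => v; rewrite lerBlDr; apply: le_trans (ple _ (u + v)) _.
    by rewrite bopD opprD addrACA [leRHS]addrC nrmD.
  rewrite le_eqVlt => /predU1P[<-|t0].
    by rewrite scale0r mul0r; apply: le_trans (pn _) _; rewrite nrm0.
  rewrite -ler_pdivrMl//; apply: (pge) => u; rewrite ler_pdivrMl//.
  apply: le_trans (ple _ (t%:C *: u)) _.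
  by rewrite bopZ -scalerBr nrmZ nrm_real gtr0_norm.
have [q [qp qD qZ]] := linear_minorant (tilt_sublinear y sp).
have qpp x : q x <= p x by apply: le_trans (qp x) (tilt_le_self _ _ sp).
have qn x : q x <= nrm x by exact: le_trans (qpp x) (pn x).
have qN x : q (- x) = - q x by rewrite -scaleN1r (_ : -1 = (-1 : R)%:C) ?qZ ?mulN1r// rmorphN1.
have qT u : q (T u) = 0.
  have h v : q (T v) <= 0.
    by apply: le_trans (qpp _) _; have := ple (T v) v; rewrite subrr nrm0.
  by apply/eqP; rewrite eq_le h/= -oppr_le0 -qN -bopN h.
have qy : d <= q y.
  rewrite -lerN2 -qN; apply: le_trans (qp _) _; apply: le_trans (tilt_opp _ sp) _.
  by rewrite lerN2; exact: pge.
exists (mk_bop (complexification_bounded qn qD qZ)).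
  apply/eqP => /(congr1 (fun f : dual V => complex.Re (f y))) /=.
  by move=> q0; move: qy; rewrite q0 leNgt d0.
apply: bopE => u /=; rewrite /complexification -bopZ !qT oppr0.
by [].
Qed.

(* If [T] were bounded below with a range that is not dense, a functional
   vanishing on the range would violate the lower bound of the adjoint. *)
Lemma bounded_below_adjoint_invertible U (T : bop U U) m : nrm_complete U ->
  0 < m -> bounded_below m T -> bounded_below m (adjoint T) ->
  exists2 C, is_inverse T C & nrm C <= m^-1.
Proof.
move=> cU m0 hT hTa; apply: bounded_below_invertible => //.
have dense y d : 0 < d -> exists x, nrm (y - T x) < d.
  move=> d0; apply: contrapT => /forallNP far.
  have [|phi phi0 Tphi] := @separating_functional _ _ T y d d0.
    by move=> x; rewrite leNgt; apply/negP; exact: far.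
  have := hTa phi; rewrite Tphi nrm0 pmulr_rle0// => h.
  by move: phi0; rewrite -nrm_gt0 ltNge h.
(* If [T x] is within [nrm y / 2] of [y], then [m * nrm x <= 3 / 2 * nrm y], which leaves room for
   the constant [2 / m]. *)
apply: (@approx_surjective _ _ _ T (m^-1 * 2) (2^-1)) => //.
- by rewrite mulr_ge0// invr_ge0 ltW.
- by rewrite invr_ge0 ler0n invf_lt1// ltr1n.
- move=> y; have [->|y0] := eqVneq y 0.
    by exists 0; rewrite bop0 subrr !nrm0 !mulr0.
  have yp : 0 < nrm y / 2 by rewrite divr_gt0// nrm_gt0.
  have [x hx] := dense y _ yp; exists x; rewrite mulrC (ltW hx); split=> //.
  rewrite -mulrA ler_pdivlMl//; apply: le_trans (hT x) _.
  rewrite -[T x](subKr y); apply: le_trans (nrmB _ _) _.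
  by lra.
Qed.

End Separation.

(** * The window inequality *)

Section Weights.
Variable R : realType.
Implicit Types (t : R) (n : nat).

(** Summation by parts: [sin (r t)] is an eigenvector of the second difference with eigenvalue
    [2 (1 - cos t)]. The last summand is the boundary term, which vanishes as soon as
    [sin (n t) = 0]. *)
Lemma sum_sqr_sinB t n :
  \sum_(r < n) (sin (r.+1%:R * t) - sin (r%:R * t)) ^+ 2 =
  2 * (1 - cos t) * \sum_(r < n) sin (r%:R * t) ^+ 2
  + sin (n%:R * t) * (sin (n%:R * t) - sin (n%:R * t - t)).
Proof.
elim: n => [|n IH]; first by rewrite !big_ord0 mulr0 mul0r sin0 mul0r addr0.
have e : n.+1%:R * t = n%:R * t + t by rewrite -natr1 mulrDl mul1r.
by rewrite !big_ord_recr/= IH e addrK sinB sinD; ring.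
Qed.

(* The weights [sin (r t)] vanish at [r = 0] and [r = n + 1]. *)
Lemma sum_sqr_sinB_window n (t := pi / n.+1%:R : R) :
  \sum_(r < n.+1) (sin (r.+1%:R * t) - sin (r%:R * t)) ^+ 2 =
  (2 * sin (pi / (2 * n.+1%:R))) ^+ 2 * \sum_(r < n) sin (r.+1%:R * t) ^+ 2.
Proof.
rewrite sum_sqr_sinB big_ord_recl mul0r sin0 expr0n/= add0r.
rewrite {2}/t mulrCA divff ?mulr1 ?pnatr_eq0// sinpi mul0r addr0; congr (_ * _).
have -> : cos t = cos (pi / (2 * n.+1%:R) *+ 2).
  by congr cos; rewrite /t -mulr_natr; field; rewrite nat1r pnatr_eq0.
by rewrite cos_mulr2n cos2sin2; ring.
Qed.

Lemma sum_sqr_sin_gt0 n (t := pi / n.+1%:R : R) : (0 < n)%N ->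
  0 < \sum_(r < n) sin (r.+1%:R * t) ^+ 2.
Proof.
case: n @t => // n t _; rewrite big_ord_recl ltr_wpDr//.
  by apply: sumr_ge0 => i _; exact: sqr_ge0.
rewrite exprn_gt0// mul1r sin_gt0_pi// divr_gt0 ?pi_gt0//=.
by rewrite ltr_pdivrMr// ltr_pMr ?pi_gt0// ltr1n.
Qed.

(** Extended by zero to all integers, since the neighbours of the rows [0] and [n + 1] are [-1] and
    [n + 2], where the sine itself does not vanish. *)
Definition window_weight n (s : int) : R :=
  if 0 < s <= n%:Z then sin (`|s|%N%:R * (pi / n.+1%:R)) else 0.

Lemma window_weight_nat n (s : nat) : (s <= n.+1)%N ->
  window_weight n s%:Z = sin (s%:R * (pi / n.+1%:R)).
Proof.
rewrite /window_weight ltz_nat lez_nat => sn.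
have [->|s0] := posnP s; first by rewrite mul0r sin0.
rewrite /=; case: leqP => // ns.
have -> : s = n.+1 by apply/eqP; rewrite eqn_leq sn.
by rewrite mulrCA divff ?mulr1 ?pnatr_eq0// sinpi.
Qed.

Lemma window_weight_out n s : ~~ (0 < s <= n%:Z) -> window_weight n s = 0.
Proof. by rewrite /window_weight => /negbTE ->. Qed.

Lemma sum_window_weight n :
  \sum_(c < n) window_weight n (1 + c%:Z) ^+ 2
  = \sum_(r < n) sin (r.+1%:R * (pi / n.+1%:R)) ^+ 2.
Proof.
apply: eq_bigr => c _; rewrite -(window_weight_nat (leqW (ltn_ord c))).
by congr (window_weight _ _ ^+ 2); lia.
Qed.

Lemma sum_window_weight_next n :
  \sum_(r < n.+2) (window_weight n (r%:Z + 1) - window_weight n r%:Z) ^+ 2 =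
  (2 * sin (pi / (2 * n.+1%:R))) ^+ 2 * \sum_(c < n) window_weight n (1 + c%:Z) ^+ 2.
Proof.
rewrite sum_window_weight -sum_sqr_sinB_window big_ord_recr/=.
rewrite [X in _ + X](_ : _ = 0) ?addr0; last first.
  rewrite !window_weight_out ?subrr ?oppr0 ?expr0n//; lia.
apply: eq_bigr => r _; have rn := ltn_ord r.
rewrite -(window_weight_nat rn) -(window_weight_nat (ltnW rn)).
by congr ((window_weight _ _ - _) ^+ 2); lia.
Qed.

Lemma sum_window_weight_prev n :
  \sum_(r < n.+2) (window_weight n (r%:Z - 1) - window_weight n r%:Z) ^+ 2 =
  (2 * sin (pi / (2 * n.+1%:R))) ^+ 2 * \sum_(c < n) window_weight n (1 + c%:Z) ^+ 2.
Proof.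
rewrite sum_window_weight -sum_sqr_sinB_window big_ord_recl/=.
rewrite [X in X + _](_ : _ = 0) ?add0r; last first.
  rewrite !window_weight_out ?subrr ?oppr0 ?expr0n//; lia.
apply: eq_bigr => r _; have rn := ltn_ord r.
rewrite -(window_weight_nat rn) -(window_weight_nat (ltnW rn)) -[LHS]sqrrN opprB.
by congr ((window_weight _ _ - window_weight _ _) ^+ 2); rewrite /bump leq0n; lia.
Qed.

End Weights.

Section Sums.
Variable R : realType.

Lemma big_seq_supp (I : eqType) (V : nmodType) (s t : seq I) (F : I -> V) :
  uniq s -> uniq t -> (forall i, i \notin s -> F i = 0) ->
  (forall i, i \notin t -> F i = 0) -> \sum_(i <- s) F i = \sum_(i <- t) F i.
Proof.
move=> us ut Fs Ft.
have mem (r q : seq I) : (forall i, i \notin q -> F i = 0) ->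
    \sum_(i <- r) F i = \sum_(i <- [seq i <- r | i \in q]) F i.
  move=> Fq; rewrite big_filter [RHS]big_mkcond/=; apply: eq_bigr => i _.
  by case: ifPn => // /Fq.
rewrite (mem s t Ft) (mem t s Fs); apply: perm_big; apply: uniq_perm.
- exact: filter_uniq.
- exact: filter_uniq.
- by move=> i; rewrite !mem_filter andbC.
Qed.

Definition near_diag (i : int) : seq int := [:: i - 1; i; i + 1].

Lemma near_diag_uniq i : uniq (near_diag i).
Proof. by rewrite /near_diag /= !inE; lia. Qed.

Lemma mem_near_diag i j : (j \in near_diag i) = (`|i - j| <= 1).
Proof. by rewrite !inE; lia. Qed.

Definition window_seq (n : nat) (k : int) : seq int :=
  [seq k + 1 + (c%:Z) | c <- iota 0 n].

Lemma window_seq_uniq n k : uniq (window_seq n k).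
Proof. by rewrite map_inj_uniq ?iota_uniq// => c d; lia. Qed.

Lemma mem_window_seq n k j : (j \in window_seq n k) = (k + 1 <= j <= k + n%:Z).
Proof.
apply/mapP/idP => [[c]|h]; first by rewrite mem_iota => ? ->; lia.
by exists (absz (j - k - 1)%R); rewrite ?mem_iota; lia.
Qed.

Lemma windowP n k j : ~ window n k j <-> j \notin window_seq n k.
Proof. by rewrite mem_window_seq; split => [/negP|/negP]. Qed.

Lemma window_weight_outside n k j :
  j \notin window_seq n k -> window_weight R n (j - k) = 0.
Proof. by rewrite mem_window_seq => h; apply: window_weight_out; lia. Qed.

Lemma big_window_seq (V : nmodType) n k (F : int -> V) :
  \sum_(c < n) F (k + 1 + c%:Z) = \sum_(j <- window_seq n k) F j.
Proof. by rewrite big_map -(big_mkord xpredT (fun c => F (k + 1 + c%:Z))) /index_iota subn0. Qed.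

Lemma sum_window_near_diag (V : nmodType) n k i (F : int -> V) :
  (forall j, j \notin window_seq n k -> F j = 0) ->
  (forall j : int, 1 < `|i - j| -> F j = 0) ->
  \sum_(c < n) F (k + 1 + c%:Z) = \sum_(j <- near_diag i) F j.
Proof.
move=> Fw Fd; rewrite big_window_seq; apply: big_seq_supp => //.
- exact: window_seq_uniq.
- exact: near_diag_uniq.
- by move=> j; rewrite mem_near_diag -ltNge; exact: Fd.
Qed.

End Sums.

Section Windows.
Variables (R : realType) (Y : normedModType R[i]).

Lemma sqsum_shift (t : int) (u : int -> Y) : sqsum (fun k => u (k + t)) = sqsum u.
Proof.
rewrite /sqsum [RHS](@reindex_esum _ _ _ setT setT (fun k => k + t))//.
split=> //; first by move=> a b _ _; exact: addIr.
by move=> a _; exists (a - t) => //; rewrite subrK.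
Qed.

Lemma sqsum_pair (J : choiceType) m (z : J * 'I_m -> Y) :
  sqsum z = (\sum_(c < m) sqsum (fun k => z (k, c)))%E.
Proof.
rewrite /sqsum -esum_sum; last by move=> k c _ _; rewrite lee_fin sqr_ge0.
transitivity (\esum_(k in [set: J]) \esum_(c in [set: 'I_m]) (nrm (z (k, c)) ^+ 2)%:E)%E.
  rewrite esum_esum; last by move=> k c _ _; rewrite lee_fin sqr_ge0.
  rewrite (_ : _ `*`` _ = setT); last by apply/seteqP; split=> // -[].
  by apply: eq_esum => -[].
apply: eq_esum => k _.
by rewrite [LHS](@sqsum_fin _ _ _ (fun c => z (k, c))) sumEFin.
Qed.

Lemma nrm_eq_sqsum (I : choiceType) (x : ell2 I Y) c : 0 <= c ->
  sqsum x = (c ^+ 2)%:E -> nrm x = c.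
Proof.
move=> c0 xc; apply/eqP; rewrite -(eqrXn2 (ltn0Sn 1)) ?nrm_ge0//.
by apply/eqP; apply: EFin_inj; rewrite -xc; apply/esym/sqsumE.
Qed.

(** All cut pieces form one vector, indexed by window and position. For a fixed position, letting
    the window vary gives a shift of [u], so the norm factorises. *)
Lemma ell2_spread m (v : 'I_m -> R) (t : 'I_m -> int) (u : ell2 int Y) :
  exists z : ell2 (int * 'I_m)%type Y,
    (forall k r, z (k, r) = (v r)%:C *: u (k + t r)) /\
    nrm z = Num.sqrt (\sum_(r < m) v r ^+ 2) * nrm u.
Proof.
pose z (p : int * 'I_m) := (v p.2)%:C *: u (p.1 + t p.2).
have v0 : 0 <= \sum_(r < m) v r ^+ 2 by apply: sumr_ge0 => r _; exact: sqr_ge0.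
have zE : sqsum z = ((Num.sqrt (\sum_(r < m) v r ^+ 2) * nrm u) ^+ 2)%:E.
  rewrite exprMn sqr_sqrtr// mulr_suml -sumEFin sqsum_pair; apply: eq_bigr => r _.
  have hu : in_ell2 (fun k => u (k + t r)).
    by rewrite /in_ell2 sqsum_shift; exact: ell2P.
  transitivity (sqsum ((v r)%:C *: mk_ell2 hu)) => //.
  rewrite [LHS](sqsumE ((v r)%:C *: mk_ell2 hu)) [ell2norm _](nrmZ (v r)%:C (mk_ell2 hu)).
  rewrite nrm_real exprMn real_normK ?num_real//.
  rewrite (@nrm_eq_sqsum _ (mk_ell2 hu) (nrm u)) ?nrm_ge0//.
  by rewrite [LHS]sqsum_shift; exact: (sqsumE u).
have hz : in_ell2 z by rewrite /in_ell2 zE ltry.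
exists (mk_ell2 hz); split=> //.
by apply: (@nrm_eq_sqsum _ (mk_ell2 hz)) => //; rewrite mulr_ge0 ?sqrtr_ge0 ?nrm_ge0.
Qed.

(** This is the action of a single diagonal of an operator matrix, with [t] selecting the
    diagonal. *)
Lemma ell2_multiplier (d : int -> bop Y Y) t c (x : ell2 int Y) :
  (forall i, nrm (d i) <= c) ->
  exists u : ell2 int Y, (forall i, u i = d i (x (i + t))) /\ nrm u <= c * nrm x.
Proof.
move=> dc; have c0 : 0 <= c by apply: le_trans (dc 0); exact: nrm_ge0.
have bnd s : uniq s -> \sum_(i <- s) nrm (d i (x (i + t))) ^+ 2 <= (c * nrm x) ^+ 2.
  move=> us; apply: (@le_trans _ _ (\sum_(i <- s) c ^+ 2 * nrm (x (i + t)) ^+ 2)).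
    apply: ler_sum => i _; rewrite -exprMn ler_pXn2r ?nnegrE ?nrm_ge0 ?mulr_ge0 ?nrm_ge0//.
    by apply: le_trans (nrm_bop_le _ _) _; rewrite ler_wpM2r ?nrm_ge0.
  rewrite -mulr_sumr exprMn ler_wpM2l ?sqr_ge0//.
  rewrite -(big_map (fun i => i + t) xpredT (fun j => nrm (x j) ^+ 2)).
  by apply: ell2_sum_le; rewrite map_inj_uniq//; exact: addIr.
exists (mk_ell2 (in_ell2_sum bnd)); split=> //; apply: ell2_nrm_le => //.
by rewrite mulr_ge0 ?nrm_ge0.
Qed.

Lemma sum_window_weight_rows n :
  \sum_(r < n.+2) window_weight R n r%:Z ^+ 2 =
  \sum_(c < n) window_weight R n (1 + c%:Z) ^+ 2.
Proof.
rewrite big_ord_recl big_ord_recr/= window_weight_out; last by lia.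
rewrite [X in _ + (_ + X ^+ 2)]window_weight_out; last by rewrite /bump leq0n; lia.
rewrite expr0n add0r addr0.
by apply: eq_bigr => c _; congr (window_weight _ _ _ ^+ 2); rewrite /bump leq0n; lia.
Qed.

Lemma nrm_fin_sqr m (z : ell2 'I_m Y) : nrm z ^+ 2 = \sum_(c < m) nrm (z c) ^+ 2.
Proof.
rewrite nrm_ell2_finE sqr_sqrtr//.
by apply: sumr_ge0 => c _; exact: sqr_ge0.
Qed.

Lemma ell2_fibre_le (J : choiceType) m m' mu (z : ell2 (J * 'I_m)%type Y)
    (w : ell2 (J * 'I_m')%type Y) : 0 <= mu ->
  (forall k, mu ^+ 2 * \sum_(c < m) nrm (z (k, c)) ^+ 2
             <= \sum_(r < m') nrm (w (k, r)) ^+ 2) ->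
  mu * nrm z <= nrm w.
Proof.
move=> mu0 h.
have fib l (u : ell2 (J * 'I_l)%type Y) :
    sqsum u = (\esum_(k in [set: J]) (\sum_(c < l) nrm (u (k, c)) ^+ 2)%:E)%E.
  rewrite sqsum_pair /sqsum -esum_sum; last by move=> k c _ _; rewrite lee_fin sqr_ge0.
  by apply: eq_esum => k _; rewrite sumEFin.
rewrite -[mu * nrm z](_ : nrm (mu%:C *: z) = _); last by rewrite nrmZ nrm_real ger0_norm.
rewrite -ler_sqr ?nnegrE ?nrm_ge0// -lee_fin.
rewrite -[X in (X <= _)%E](sqsumE (mu%:C *: z)) -[X in (_ <= X)%E](sqsumE w) !fib.
apply: le_esum => k _; rewrite lee_fin; apply: le_trans (h k).
rewrite mulr_sumr; apply: ler_sum => c _.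
by rewrite ell2_scaleE nrmZ nrm_real exprMn real_normK ?num_real.
Qed.

Lemma plusmx_windowE (b : int -> int -> bop Y Y) n (k : int) (F : int -> Y)
    (z : ell2 'I_n Y) (r : 'I_n.+2) :
  (forall i j : int, 1 < `|i - j| -> b i j = 0) ->
  (forall j, j \notin window_seq n k -> F j = 0) ->
  (forall c : 'I_n, z c = F (k + 1 + c%:Z)) ->
  mxact (plusmx b n k) z r = \sum_(j <- near_diag (k + r%:Z)) b (k + r%:Z) j (F j).
Proof.
move=> b0 F0 zF /=.
rewrite -(@sum_window_near_diag _ n k _ (fun j => b (k + r%:Z) j (F j))).
- by apply: eq_bigr => c _; rewrite mxE zF.
- by move=> j /F0 ->; rewrite bop0.
- by move=> j /b0 ->.
Qed.

(** Here [p], [q], [r] are the weights at three neighbouring positions and [u], [v], [w] the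
    contributions of the three diagonals. The main diagonal carries the weight [q] of its own row
    and leaves no commutator. *)
Lemma scaler_commutator (p q r : R[i]) (u v w : Y) :
  p *: u + (q *: v + r *: w) = q *: (u + (v + w)) + (p - q) *: u + (r - q) *: w.
Proof.
rewrite !scalerBl !scalerDr [X in _ = X + _](_ : _ = p *: u + (q *: v + q *: w)).
  by rewrite -!addrA [q *: w + _]addrC subrK.
by rewrite addrC addrA subrK.
Qed.

(* Cutting [x] with the weights and summing over all windows, [f] is the sum of the
   cut pieces of [y], while [g] and [h] collect the commutator of the operator with
   multiplication by the weights. *)
Lemma window_lower_bound (b : int -> int -> bop Y Y) ca cg n mu (x y : ell2 int Y) :
  (forall i j : int, 1 < `|i - j| -> b i j = 0) ->
  (forall j, nrm (b (j + 1) j) <= ca) -> (forall j, nrm (b (j - 1) j) <= cg) ->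
  (forall i, y i = \sum_(j <- near_diag i) b i j (x j)) -> (0 < n)%N ->
  (forall k, bounded_below mu (mxact (plusmx b n k))) ->
  mu * nrm x <= nrm y + 2 * (ca + cg) * sin (pi / (2 * n.+1%:R)) * nrm x.
Proof.
move=> b0 hca hcg yE n0 hmu.
set s := sin _; pose W := window_weight R n.
have s0 : 0 <= s.
  rewrite /s ltW// sin_gt0_pi// divr_gt0 ?pi_gt0 ?mulr_gt0//=.
  by rewrite ltr_pdivrMr ?mulr_gt0// ltr_pMr ?pi_gt0// -natrM ltr1n; lia.
have ca0 : 0 <= ca by apply: le_trans (hca 0); exact: nrm_ge0.
have cg0 : 0 <= cg by apply: le_trans (hcg 0); exact: nrm_ge0.
have rhs0 : 0 <= nrm y + 2 * (ca + cg) * s * nrm x.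
  by rewrite addr_ge0 ?mulr_ge0 ?nrm_ge0 ?addr_ge0.
have [mu0|mu0] := leP 0 mu; last first.
  by apply: le_trans rhs0; rewrite mulr_le0_ge0 ?nrm_ge0 ?ltW.
pose Q := \sum_(c < n) W (1 + c%:Z) ^+ 2.
have Q0 : 0 < Q by rewrite /Q /W sum_window_weight sum_sqr_sin_gt0.
have sQ0 : 0 < Num.sqrt Q by rewrite sqrtr_gt0.
have sqrtsQ : Num.sqrt ((2 * s) ^+ 2 * Q) = 2 * s * Num.sqrt Q.
  by rewrite sqrtrM ?sqr_ge0// sqrtr_sqr ger0_norm// mulr_ge0.
have [Z [ZE nZ]] := ell2_spread (fun c : 'I_n => W (1 + c%:Z)) (fun c => 1 + c%:Z) x.
(* [ug] and [uh] are the images of [x] under the subdiagonal and the superdiagonal of [b]. *)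
have [|ug [ugE nug]] := @ell2_multiplier (fun i => b i (i - 1)) (- 1) ca x.
  by move=> i; have := hca (i - 1); rewrite subrK.
have [|uh [uhE nuh]] := @ell2_multiplier (fun i => b i (i + 1)) 1 cg x.
  by move=> i; have := hcg (i + 1); rewrite addrK.
have [f [fE nf]] := ell2_spread (fun r : 'I_n.+2 => W r%:Z) (fun r => r%:Z) y.
have [g [gE ng]] :=
  ell2_spread (fun r : 'I_n.+2 => W (r%:Z - 1) - W r%:Z) (fun r => r%:Z) ug.
have [h [hE nh]] :=
  ell2_spread (fun r : 'I_n.+2 => W (r%:Z + 1) - W r%:Z) (fun r => r%:Z) uh.
rewrite sum_window_weight_rows -/Q in nf.
rewrite sum_window_weight_prev -/Q -/s sqrtsQ in ng.
rewrite sum_window_weight_next -/Q -/s sqrtsQ in nh.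
rewrite -/Q in nZ.
have key : mu * nrm Z <= nrm (f + g + h).
  apply: ell2_fibre_le => // k.
  pose zk := mk_ell2 (in_ell2_fin (fun c => Z (k, c))).
  have zkE c : zk c = (W (k + 1 + c%:Z - k))%:C *: x (k + 1 + c%:Z).
    have -> : k + 1 + c%:Z - k = 1 + c%:Z by rewrite -addrA addrC addrA subrK addrC.
    by rewrite -addrA; exact: ZE.
  have : (mu * nrm zk) ^+ 2 <= nrm (mxact (plusmx b n k) zk) ^+ 2.
    by rewrite ler_pXn2r ?nnegrE ?mulr_ge0 ?nrm_ge0// hmu.
  rewrite exprMn !nrm_fin_sqr => /le_trans; apply; rewrite le_eqVlt; apply/orP; left; apply/eqP.
  apply: eq_bigr => r _; congr (nrm _ ^+ 2).
  rewrite (@plusmx_windowE _ _ _ (fun j => (W (j - k))%:C *: x j))//; last first.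
    by move=> j jw; rewrite /W window_weight_outside// scale0r.
  rewrite !ell2_addE fE gE hE ugE uhE yE !big_cons !big_nil !addr0 !bopZ.
  have -> : k + r%:Z - 1 - k = r%:Z - 1 by rewrite addrAC [k + _]addrC addrK.
  have -> : k + r%:Z + 1 - k = r%:Z + 1 by rewrite addrAC [k + _]addrC addrK.
  have -> : k + r%:Z - k = r%:Z by rewrite [k + _]addrC addrK.
  by rewrite !rmorphB/=; exact: scaler_commutator.
have := le_trans key (le_trans (nrmD _ _) (lerD (nrmD _ _) (lexx _))).
rewrite nZ nf ng nh => {}key.
(* The common factor [Num.sqrt Q] of all four norms cancels. *)
rewrite -(ler_pM2l sQ0) mulrCA; apply: le_trans key _.
apply: (@le_trans _ _ (Num.sqrt Q * nrm y + 2 * s * Num.sqrt Q * (ca * nrm x)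
  + 2 * s * Num.sqrt Q * (cg * nrm x))).
  by rewrite !lerD// ler_wpM2l ?mulr_ge0 ?sqrtr_ge0.
by rewrite le_eqVlt; apply/orP; left; apply/eqP; ring.
Qed.

End Windows.

(** * The dual of l^2(I, X) *)

Section FiniteSupport.
Variable R : realType.

Lemma sum_mul_le_sqrt (I : Type) (s : seq I) (a b : I -> R) :
  \sum_(i <- s) a i * b i <=
  Num.sqrt (\sum_(i <- s) a i ^+ 2) * Num.sqrt (\sum_(i <- s) b i ^+ 2).
Proof.
elim: s => [|i s IH]; first by rewrite !big_nil sqrtr0 mul0r.
rewrite !big_cons; apply: le_trans (lerD (lexx _) IH) _.
set A := \sum_(j <- s) a j ^+ 2; set B := \sum_(j <- s) b j ^+ 2.
have A0 : 0 <= A by apply: sumr_ge0 => j _; exact: sqr_ge0.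
have B0 : 0 <= B by apply: sumr_ge0 => j _; exact: sqr_ge0.
rewrite -{2}(sqr_sqrtr A0) -{2}(sqr_sqrtr B0).
set p := Num.sqrt A; set q := Num.sqrt B.
rewrite -sqrtrM ?addr_ge0 ?sqr_ge0//; apply: le_trans (ler_norm _) _.
rewrite -sqrtr_sqr ler_wsqrtr// -subr_ge0.
by rewrite [X in 0 <= X](_ : _ = (a i * q - p * b i) ^+ 2) ?sqr_ge0//; ring.
Qed.

Lemma ler_sum_uniq_sub (I : eqType) (s t : seq I) (F : I -> R) :
  uniq s -> uniq t -> {subset s <= t} -> (forall i, 0 <= F i) ->
  \sum_(i <- s) F i <= \sum_(i <- t) F i.
Proof.
move=> us ut st F0; rewrite [leRHS](bigID (mem s))/= -[leLHS]addr0 lerD ?sumr_ge0//.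
rewrite -[leRHS]big_filter [leRHS](perm_big s)//=.
apply: uniq_perm; rewrite ?filter_uniq// => i.
by rewrite mem_filter; case: (boolP (i \in s)) => //= /st ->.
Qed.

Variables (I : choiceType) (X : normedModType R[i]).
Implicit Types x : ell2 I X.

Lemma nrm_ell2_supp x (s : seq I) : uniq s -> (forall i, i \notin s -> x i = 0) ->
  nrm x ^+ 2 = \sum_(i <- s) nrm (x i) ^+ 2.
Proof.
move=> us xs; apply/eqP; rewrite eq_le ell2_sum_le// andbT.
have S0 : 0 <= \sum_(i <- s) nrm (x i) ^+ 2 by apply: sumr_ge0 => i _; exact: sqr_ge0.
rewrite -(sqr_sqrtr S0) ler_pXn2r ?nnegrE ?nrm_ge0 ?sqrtr_ge0//.
apply: ell2_nrm_le; first exact: sqrtr_ge0.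
move=> t ut; rewrite sqr_sqrtr// (bigID (mem s))/= [X in _ + X]big1 ?addr0; last first.
  by move=> i /xs ->; rewrite nrm0 expr0n.
rewrite -big_filter; apply: ler_sum_uniq_sub => // [|i|i]; first exact: filter_uniq.
  by rewrite mem_filter => /andP[].
exact: sqr_ge0.
Qed.

Definition truncate (s : seq I) x : ell2 I X := \sum_(i <- s) ell2_single i (x i).

Lemma truncateE s x i : uniq s -> truncate s x i = if i \in s then x i else 0.
Proof.
move=> us; rewrite /truncate ell2_sumE; case: ifPn => is_.
  rewrite (@big_seq_pred1 _ _ _ i)// ?ell2_singleE ?eqxx// => j ji.
  by rewrite ell2_singleE eq_sym (negbTE ji).
rewrite big_seq big1// => j js; rewrite ell2_singleE.
by case: eqP => // ij; rewrite ij js in is_.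
Qed.

Lemma truncate_approx x (e : R) : 0 < e ->
  exists2 s, uniq s & nrm (x - truncate s x) <= e.
Proof.
move=> e0; have e20 : 0 < e ^+ 2 by rewrite exprn_gt0.
(* A finite set that captures all but [e ^ 2] of the squared norm leaves at most [e ^ 2] to any
   finite set of further indices. *)
have [s us hs] : exists2 s, uniq s & nrm x ^+ 2 - e ^+ 2 <= \sum_(i <- s) nrm (x i) ^+ 2.
  apply: contrapT => far.
  have b s : uniq s -> \sum_(i <- s) nrm (x i) ^+ 2 <= nrm x ^+ 2 - e ^+ 2.
    move=> us; rewrite leNgt; apply/negP => lt; apply: far.
    by exists s => //; exact: ltW.
  have d0 : 0 <= nrm x ^+ 2 - e ^+ 2 by have := b [::] isT; rewrite big_nil.
  have : nrm x <= Num.sqrt (nrm x ^+ 2 - e ^+ 2).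
    by apply: ell2_nrm_le; rewrite ?sqrtr_ge0// => s us; rewrite sqr_sqrtr ?b.
  move=> lt; have : nrm x ^+ 2 <= nrm x ^+ 2 - e ^+ 2.
    by rewrite -(sqr_sqrtr d0) ler_pXn2r ?nnegrE ?nrm_ge0 ?sqrtr_ge0.
  by rewrite lerBrDr gerDl leNgt e20.
exists s => //; set d : ell2 I X := x - _.
have dE i : d i = if i \in s then 0 else x i.
  rewrite -[LHS]/(x i - truncate s x i) truncateE//.
  by case: ifP; rewrite ?subrr ?subr0.
move: d dE => d dE; apply: ell2_nrm_le (ltW e0) _ => t ut.
have h := ell2_sum_le x (undup_uniq (s ++ t)).
apply: (@le_trans _ _ (nrm x ^+ 2 - \sum_(i <- s) nrm (x i) ^+ 2)); last first.
  by rewrite lerBlDr addrC -lerBlDr.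
rewrite lerBrDr; apply: le_trans h.
rewrite [leRHS](bigID (mem s))/= addrC lerD//; last first.
  rewrite -[leRHS]big_filter; apply: ler_sum_uniq_sub => // [|i is_|i].
  - by rewrite filter_uniq ?undup_uniq.
  - by rewrite mem_filter is_ mem_undup mem_cat is_.
  - exact: sqr_ge0.
rewrite [leLHS](bigID (mem s))/= [X in X + _]big1 ?add0r; last first.
  by move=> i is_; rewrite dE is_ nrm0 expr0n.
rewrite -[leLHS]big_filter -[leRHS]big_filter.
rewrite (eq_big_seq (fun i => nrm (x i) ^+ 2)); last first.
  by move=> i; rewrite mem_filter => /andP[is_ _]; rewrite dE (negbTE is_).
apply: ler_sum_uniq_sub; rewrite ?filter_uniq ?undup_uniq// => i; last exact: sqr_ge0.
by rewrite !mem_filter mem_undup mem_cat => /andP[-> ->]; rewrite orbT.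
Qed.

End FiniteSupport.

Section Dual.
Variable R : realType.

Lemma dual_norming (X : normedModType R[i]) (psi : dual X) (e : R) : 0 < e ->
  exists2 u : X, nrm u <= 1 & nrm psi - e <= complex.Re (psi u).
Proof.
move=> e0.
have [v v1 hv] : exists2 v : X, nrm v <= 1 & nrm psi - e <= nrm (psi v).
  apply: contrapT => far.
  have : (opnorm psi <= (nrm psi - e)%:E)%E.
    apply: ge_ereal_sup => _ [v /= v1 <-]; rewrite lee_fin leNgt; apply/negP => lt.
    by apply: far; exists v => //; exact: ltW.
  by rewrite -nrm_bopE lee_fin lerBrDr gerDl leNgt e0.
have [z0|z0] := eqVneq (psi v) 0.
  exists 0; first by rewrite nrm0.
  by apply: le_trans hv _; rewrite bop0 z0 nrm0.
(* A unimodular factor turns the value of [psi] into its modulus. *)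
exists (((nrm (psi v))%:C / psi v) *: v).
  by rewrite nrmZ nrmM nrm_real ger0_norm ?nrm_ge0// nrmV divff ?mul1r// gt_eqF ?nrm_gt0.
by rewrite bopZ; have -> : ((nrm (psi v))%:C / psi v) *: (psi v : R[i]^o)
  = (nrm (psi v))%:C :> R[i] by rewrite /GRing.scale/= divfK.
Qed.

Variables (I : choiceType) (X : normedModType R[i]).

Lemma bounded_ell2_single (j : I) : bounded_op (ell2_single j : X -> ell2 I X).
Proof.
split; last by exists 1 => u; rewrite nrm_ell2_single mul1r.
by move=> c u v; rewrite ell2_singleD ell2_singleZ.
Qed.

Definition dual_coord (phi : dual (ell2 I X)) (j : I) : dual X :=
  bop_comp phi (mk_bop (bounded_ell2_single j)).

Lemma dual_coordE phi j u : dual_coord phi j u = phi (ell2_single j u).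
Proof. by []. Qed.

Lemma Re_sum (J : Type) (s : seq J) (F : J -> R[i]) :
  complex.Re (\sum_(j <- s) F j) = \sum_(j <- s) complex.Re (F j).
Proof. by elim/big_rec2: _ => // j a [b c] _ <-; case: (F j). Qed.

(** Let [x] be the sum over [s] of [nrm phi_j] times a vector [u_j] that almost norms the component
    [phi_j]. Then [nrm x] is at most the square root of the sum [S], while [Re (phi x)] is almost
    [S]; hence [S <= nrm phi * Num.sqrt S]. *)
Lemma dual_coord_sum_le (phi : dual (ell2 I X)) (s : seq I) : uniq s ->
  \sum_(j <- s) nrm (dual_coord phi j) ^+ 2 <= nrm phi ^+ 2.
Proof.
move=> us; set S := \sum_(j <- s) _.
have S0 : 0 <= S by apply: sumr_ge0 => j _; exact: sqr_ge0.
suff h : S <= nrm phi * Num.sqrt S.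
  have [s0|s0] := eqVneq (Num.sqrt S) 0.
    by apply: le_trans h _; rewrite s0 mulr0 sqr_ge0.
  have sp : 0 < Num.sqrt S by rewrite lt_neqAle eq_sym s0 sqrtr_ge0.
  move: h; rewrite -{1}(sqr_sqrtr S0) expr2 ler_pM2r// => h.
  by rewrite -(sqr_sqrtr S0) ler_pXn2r ?nnegrE ?nrm_ge0 ?sqrtr_ge0.
set T := \sum_(j <- s) nrm (dual_coord phi j).
have T0 : 0 <= T by apply: sumr_ge0 => j _; exact: nrm_ge0.
apply/ler_addgt0Pr => e e0.
have T1 : 0 < T + 1 by rewrite ltr_wpDl.
(* The errors in the components get multiplied by [nrm phi_j], which sum to [T]; the [+ 1] avoids a
   division by zero. *)
have d0 : 0 < e / (T + 1) by rewrite divr_gt0.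
have /choice[u hu] : forall j, exists u : X, nrm u <= 1 /\
    nrm (dual_coord phi j) - e / (T + 1) <= complex.Re (dual_coord phi j u).
  by move=> j; have [u u1 hu] := dual_norming (dual_coord phi j) d0; exists u.
pose x : ell2 I X := \sum_(j <- s) (nrm (dual_coord phi j))%:C *: ell2_single j (u j).
have xE i : x i = if i \in s then (nrm (dual_coord phi i))%:C *: u i else 0.
  rewrite /x ell2_sumE; case: ifPn => is_.
    rewrite (@big_seq_pred1 _ _ _ i)// ?ell2_scaleE ?ell2_singleE ?eqxx// => j ji.
    by rewrite ell2_scaleE ell2_singleE eq_sym (negbTE ji) scaler0.
  rewrite big_seq big1// => j js; rewrite ell2_scaleE ell2_singleE.
  by case: eqP => [ij|]; rewrite ?scaler0//; rewrite ij js in is_.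
have phix : S - e <= complex.Re (phi x).
  rewrite /x bop_sum Re_sum.
  apply: (@le_trans _ _ (S - e / (T + 1) * T)).
    by rewrite lerB// mulrAC ler_pdivrMr// ler_wpM2l ?(ltW e0)// lerDl.
  rewrite /S /T mulr_sumr -sumrB; apply: ler_sum => j _.
  rewrite bopZ -dual_coordE /GRing.scale/=.
  have -> (a : R) (z : R[i]) : complex.Re (a%:C * z) = a * complex.Re z.
    by case: z => b c; rewrite /= mul0r subr0.
  rewrite expr2 [e / _ * _]mulrC -mulrBr ler_wpM2l ?nrm_ge0//.
  exact: (hu j).2.
move: x xE phix => x xE phix.
have nx : nrm x <= Num.sqrt S.
  rewrite -[nrm x]ger0_norm ?nrm_ge0// -sqrtr_sqr ler_wsqrtr//.
  rewrite (@nrm_ell2_supp _ _ _ x s)// => [|i is_]; last by rewrite xE (negbTE is_).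
  rewrite /S big_seq [leRHS]big_seq; apply: ler_sum => i is_.
  rewrite xE is_ ler_pXn2r ?nnegrE ?nrm_ge0// nrmZ nrm_real ger0_norm ?nrm_ge0//.
  by rewrite -[leRHS]mulr1 ler_wpM2l ?nrm_ge0 ?(hu i).1.
rewrite -lerBlDr; apply: le_trans phix _; apply: le_trans (ler_norm _) _.
apply: le_trans (Re_le_nrm _) _; apply: le_trans (nrm_bop_le phi x) _.
by rewrite ler_wpM2l ?nrm_ge0.
Qed.

Definition dual_ell2 (phi : dual (ell2 I X)) : ell2 I (dual X) :=
  mk_ell2 (in_ell2_sum (dual_coord_sum_le phi)).

Lemma dual_ell2E phi j u : dual_ell2 phi j u = phi (ell2_single j u).
Proof. by []. Qed.

(** The upper bound on [nrm phi] is the Cauchy-Schwarz inequality on finitely supported vectors,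
    which are dense. *)
Lemma nrm_dual_ell2 phi : nrm (dual_ell2 phi) = nrm phi.
Proof.
apply/eqP; rewrite eq_le; apply/andP; split.
  by apply: ell2_nrm_le (nrm_ge0 _) _; exact: dual_coord_sum_le.
apply: nrm_bop_ub (nrm_ge0 _) _ => x.
apply/ler_addgt0Pr => e e0.
have p1 : 0 < nrm phi + 1 by rewrite ltr_wpDl ?nrm_ge0.
have [s us hs] := truncate_approx x (divr_gt0 e0 p1).
rewrite -(subrK (truncate s x) x) bopD addrC; apply: le_trans (nrmD _ _) _.
rewrite lerD//; last first.
  apply: le_trans (nrm_bop_le _ _) _; move: hs; rewrite ler_pdivlMr// mulrC.
  by apply: le_trans; rewrite ler_wpM2r ?nrm_ge0// lerDl.
rewrite subrK /truncate bop_sum; apply: le_trans (nrm_sum _ _ _) _.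
apply: (@le_trans _ _ (\sum_(i <- s) nrm (dual_ell2 phi i) * nrm (x i))).
  by apply: ler_sum => i _; rewrite -dual_ell2E nrm_bop_le.
apply: le_trans (sum_mul_le_sqrt _ _ _) _.
rewrite ler_pM ?sqrtr_ge0//.
- rewrite -[leRHS]ger0_norm ?nrm_ge0// -sqrtr_sqr ler_wsqrtr//.
  exact: ell2_sum_le.
- rewrite -[leRHS]ger0_norm ?nrm_ge0// -sqrtr_sqr ler_wsqrtr//.
  exact: ell2_sum_le.
Qed.

Lemma bounded_sum_coord (s : seq I) (psi : I -> dual X) :
  bounded_op (fun x : ell2 I X => \sum_(j <- s) psi j (x j) : R[i]^o).
Proof.
split=> [c x y|].
  rewrite scaler_sumr -big_split/=; apply: eq_bigr => j _.
  exact: (bop_linear (psi j) c (x j) (y j)).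
exists (\sum_(j <- s) nrm (psi j)) => x; apply: le_trans (nrm_sum _ _ _) _.
rewrite mulr_suml; apply: ler_sum => j _; apply: le_trans (nrm_bop_le _ _) _.
by rewrite ler_wpM2l ?nrm_ge0// ell2_coord_le.
Qed.

(** Finitely supported sequences suffice to identify the functionals supported in a window with
    columns over the dual. *)
Lemma dual_ell2_surj (s : seq I) (z : ell2 I (dual X)) : uniq s ->
  (forall j, j \notin s -> z j = 0) -> exists phi, dual_ell2 phi = z.
Proof.
move=> us zs; exists (mk_bop (bounded_sum_coord s z)).
apply: ell2_eq => i; apply: bopE => u; rewrite dual_ell2E /=.
have [is_|is_] := boolP (i \in s).
  rewrite (@big_seq_pred1 _ _ _ i)// => [|j ji]; first by rewrite eqxx.
  by rewrite (negbTE ji) bop0.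
rewrite (zs i is_) big_seq big1// => j js.
by case: eqP => [ji|]; rewrite ?bop0//; rewrite -ji js in is_.
Qed.

End Dual.

(** * Lower norms of sections and of matrices *)

Section Restriction.
Variables (R : realType) (Y : normedModType R[i]).
Implicit Types (x y : ell2 int Y) (b : int -> int -> bop Y Y) (n : nat) (k : int).

Definition restrict n k x : ell2 'I_n Y :=
  mk_ell2 (in_ell2_fin (fun c : 'I_n => x (k + 1 + c%:Z))).

Definition extend n k (z : ell2 'I_n Y) : ell2 int Y :=
  \sum_(c < n) ell2_single (k + 1 + c%:Z) (z c).

Lemma restrictE n k x c : restrict n k x c = x (k + 1 + c%:Z).
Proof. by []. Qed.

Lemma nrm_restrict n k x : (forall j, j \notin window_seq n k -> x j = 0) ->
  nrm (restrict n k x) = nrm x.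
Proof.
move=> xw; apply/eqP; rewrite -(eqrXn2 (ltn0Sn 1)) ?nrm_ge0// nrm_fin_sqr.
rewrite (nrm_ell2_supp (window_seq_uniq n k) xw) -big_window_seq.
by apply/eqP; apply: eq_bigr.
Qed.

Lemma extend_out n k (z : ell2 'I_n Y) j :
  j \notin window_seq n k -> extend k z j = 0.
Proof.
rewrite mem_window_seq /extend ell2_sumE => jw; rewrite big1// => c _.
by rewrite ell2_singleE; case: eqP => // jc; have := ltn_ord c; lia.
Qed.

Lemma restrict_extend n k (z : ell2 'I_n Y) : restrict n k (extend k z) = z.
Proof.
apply: ell2_eq => c; rewrite restrictE /extend ell2_sumE (bigD1 c)//= eqxx.
rewrite big1 ?addr0// => d dc; case: eqP => // cd; case/eqP: dc.
by apply/val_inj => /=; lia.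
Qed.

Lemma tridiagonal_out b n k x y i : (forall i j : int, 1 < `|i - j| -> b i j = 0) ->
  (forall i, y i = \sum_(j <- near_diag i) b i j (x j)) ->
  (forall j, j \notin window_seq n k -> x j = 0) ->
  i \notin window_seq n.+2 (k - 1) -> y i = 0.
Proof.
move=> b0 yE xw iw; rewrite yE big_seq big1// => j.
rewrite mem_near_diag => ij; rewrite xw ?bop0//.
by move: iw; rewrite !mem_window_seq; lia.
Qed.

(** The rows of the section contain every row that a vector supported in the window can reach, so
    passing to the section loses nothing of the image. *)
Lemma mxact_restrict b n k x y : (forall i j : int, 1 < `|i - j| -> b i j = 0) ->
  (forall i, y i = \sum_(j <- near_diag i) b i j (x j)) ->
  (forall j, j \notin window_seq n k -> x j = 0) ->
  nrm (mxact (plusmx b n k) (restrict n k x)) = nrm y.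
Proof.
move=> b0 yE xw.
(* Windows start one past their base, so the rows [k, ..., k + n + 1] are the window of length
   [n + 2] based at [k - 1]. *)
rewrite -(@nrm_restrict n.+2 (k - 1) y); last by move=> i; exact: tridiagonal_out b0 yE xw.
congr nrm; apply: ell2_eq => r.
by rewrite (@plusmx_windowE _ _ _ _ _ x)// restrictE subrK yE.
Qed.

Definition shiftmx b (l : R[i]) (i j : int) : bop Y Y :=
  b i j - (if i == j then l *: bop_id Y else 0).

Lemma shiftmx_tridiagonal b l : (forall i j : int, 1 < `|i - j| -> b i j = 0) ->
  forall i j : int, 1 < `|i - j| -> shiftmx b l i j = 0.
Proof.
move=> b0 i j ij; rewrite /shiftmx b0//; case: eqP => [e|]; rewrite ?subr0//.
by move: ij; rewrite e subrr normr0 ltr10.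
Qed.

Lemma shiftmx_next b l j : shiftmx b l (j + 1) j = b (j + 1) j.
Proof. by rewrite /shiftmx ifF ?subr0//; lia. Qed.

Lemma shiftmx_prev b l j : shiftmx b l (j - 1) j = b (j - 1) j.
Proof. by rewrite /shiftmx ifF ?subr0//; lia. Qed.

Lemma plusmx_shiftmx b l n k :
  plusmx (shiftmx b l) n k = plusmx b n k - scaled_Iplus Y n l.
Proof.
apply/matrixP => r c; rewrite !mxE /shiftmx.
have -> : (k + r%:Z == k + 1 + c%:Z) = (r == c.+1 :> nat) by lia.
by [].
Qed.

End Restriction.

Section LowerNorms.
Variables (R : realType) (X : normedModType R[i]).
Implicit Types (B : bop (ell2 int X) (ell2 int X)) (b : int -> int -> bop X X).

Lemma tridiagonal_shiftmx B b (l : R[i]) :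
  tridiagonal B b -> tridiagonal (B - l *: bop_id _) (shiftmx b l).
Proof.
move=> [b0 BE]; split; first exact: shiftmx_tridiagonal.
move=> x i; rewrite -[LHS]/(B x i - l *: x i) BE !big_cons big_nil /shiftmx.
have -> : (i == i - 1) = false by lia.
have -> : (i == i + 1) = false by lia.
rewrite eqxx !subr0 !addr0 bop_subE bop_scaleE addrA -!addrA; congr (_ + (_ + _)).
by rewrite big_nil addr0 addrC.
Qed.

Lemma adjmx_shiftmx b (l : R[i]) : adjmx (shiftmx b l) = shiftmx (adjmx b) l.
Proof.
apply/funext => i; apply/funext => j; rewrite /adjmx /shiftmx adjointB eq_sym.
congr (_ - _); case: eqP => _; apply: bopE => phi; apply: bopE => u.
  by rewrite /= bopZ.
by rewrite /= bop0.
Qed.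

Lemma adjmx_tridiagonal b : (forall i j : int, 1 < `|i - j| -> b i j = 0) ->
  forall i j : int, 1 < `|i - j| -> adjmx b i j = 0.
Proof.
move=> b0 i j; rewrite distrC => /b0 b0'; rewrite /adjmx b0'.
by apply: bopE => phi; apply: bopE => u; rewrite /= bop0.
Qed.

Lemma tridiagonal_single B b i u : tridiagonal B b ->
  B (ell2_single i u) = \sum_(j <- near_diag i) ell2_single j (b j i u).
Proof.
move=> [b0 BE]; apply: ell2_eq => r; rewrite BE ell2_sumE.
transitivity (if r \in near_diag i then b r i u else 0).
  case: ifPn => ri.
    rewrite (@big_seq_pred1 _ _ _ i)//.
    - by rewrite ell2_singleE eqxx.
    - exact: near_diag_uniq.
    - by move: ri; rewrite !mem_near_diag distrC.
    - by move=> j ji; rewrite ell2_singleE (negbTE ji) bop0.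
  rewrite big_seq big1// => j jr; rewrite ell2_singleE; case: eqP => [ji|_].
    by move: jr ri; rewrite !mem_near_diag ji distrC => ->.
  by rewrite bop0.
case: ifPn => ri.
  rewrite (@big_seq_pred1 _ _ _ r) ?near_diag_uniq// ?ell2_singleE ?eqxx//.
  by move=> j jr; rewrite ell2_singleE eq_sym (negbTE jr).
rewrite big_seq big1// => j ji; rewrite ell2_singleE; case: eqP => // rj.
by rewrite rj ji in ri.
Qed.

Lemma dual_ell2_adjoint B b (phi : dual (ell2 int X)) i : tridiagonal B b ->
  dual_ell2 (adjoint B phi) i = \sum_(j <- near_diag i) adjmx b i j (dual_ell2 phi j).
Proof.
move=> hB; apply: bopE => u; rewrite bop_sumE dual_ell2E.
rewrite -[LHS]/(phi (B (ell2_single i u))) (tridiagonal_single _ _ hB) bop_sum.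
by [].
Qed.

Lemma lower_norm_En B b n k : tridiagonal B b ->
  lower_norm (@En R X n k) B = lower_norm setT (mxact (plusmx b n k)).
Proof.
move=> hB; have [b0 BE] := hB; congr ereal_inf; apply/seteqP; split.
  move=> _ [x [/= xw x1] <-].
  have xw' j : j \notin window_seq n k -> x j = 0 by move=> /windowP; exact: xw.
  exists (restrict n k x); first by split=> //=; rewrite nrm_restrict.
  by rewrite (mxact_restrict b0 (BE x) xw').
move=> _ [z [_ /= z1] <-].
have ew j := @extend_out _ _ n k z j.
exists (extend k z); last first.
  by rewrite -(mxact_restrict b0 (BE _) ew) restrict_extend.
split=> [j /windowP|/=]; first exact: ew.
by rewrite -(nrm_restrict ew) restrict_extend.
Qed.

Lemma lower_norm_En_dual B b n k : tridiagonal B b ->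
  lower_norm (@En_dual R X n k) (adjoint B) = lower_norm setT (mxact (plusmx (adjmx b) n k)).
Proof.
move=> hB; have [b0 _] := hB; have b0' := adjmx_tridiagonal b0.
have BE phi i := dual_ell2_adjoint phi i hB.
congr ereal_inf; apply/seteqP; split.
  move=> _ [phi [/= phiw phi1] <-].
  have xw j : j \notin window_seq n k -> dual_ell2 phi j = 0.
    by move=> /windowP jw; apply: bopE => u; exact: phiw.
  exists (restrict n k (dual_ell2 phi)).
    by split=> //=; rewrite nrm_restrict// nrm_dual_ell2.
  by rewrite (mxact_restrict b0' (BE phi) xw) nrm_dual_ell2.
move=> _ [z [_ /= z1] <-].
have ew j := @extend_out _ _ n k z j.
have [phi phiE] := dual_ell2_surj (window_seq_uniq n k) ew.
have pw j : j \notin window_seq n k -> dual_ell2 phi j = 0 by rewrite phiE; exact: ew.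
exists phi; last by rewrite -nrm_dual_ell2 -(mxact_restrict b0' (BE phi) pw) phiE restrict_extend.
split=> [j /windowP jw u|/=].
  by rewrite -[LHS]/(dual_ell2 phi j u) phiE ew.
by rewrite -nrm_dual_ell2 phiE -(nrm_restrict ew) restrict_extend.
Qed.

End LowerNorms.

(** * The two inclusions *)

Section LowerBounds.
Variable R : realType.
Implicit Types U V : normedModType R[i].

Definition both_below U (m : R) (B : bop U U) :=
  bounded_below m B /\ bounded_below m (adjoint B).

(** Passing to complements gives the cases [eps = 0] and [eps > 0] one common form: there is a
    common lower bound strictly above [eps]. *)
Lemma Spec_epsP U (A : bop U U) eps (l : R[i]) : nrm_complete U -> 0 <= eps ->
  ~ Spec_eps eps A l <-> exists2 m, eps < m & both_below m (A - l *: bop_id U).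
Proof.
move=> cU eps0; set B := A - _; rewrite /Spec_eps; split.
  case: eqVneq => [->|en0] /=.
    move/contrapT => [C hC]; exists (nrm C + 1)^-1.
      by rewrite invr_gt0 ltr_wpDl ?nrm_ge0.
    apply: inverse_bounded_below hC _ _; first by rewrite invr_ge0 addr_ge0 ?nrm_ge0.
    by rewrite mulrC ler_pdivrMr ?ltr_wpDl ?nrm_ge0// mul1r lerDl.
  rewrite -/B /inv_norm; case: pselect => [H|nH]; last by rewrite invey lee_fin.
  case: (cid H) => C hC /=; rewrite inver; case: eqVneq => [C0 _|C0].
    (* An inverse of norm 0 occurs only on the trivial space, where every number is a lower
       bound. *)
    exists (eps + 1); first by rewrite ltrDl.
    by apply: inverse_bounded_below hC _ _; rewrite ?addr_ge0// C0 mulr0.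
  move/negP; rewrite lee_fin -ltNge => lt; exists (nrm C)^-1 => //.
  by apply: inverse_bounded_below hC _ _; rewrite ?invr_ge0 ?nrm_ge0// mulVf.
move=> [m em [hB hBa]]; have m0 : 0 < m by exact: le_lt_trans em.
have [C hC nC] := bounded_below_adjoint_invertible cU m0 hB hBa.
case: eqVneq => [e0|en0] /=; first by apply; exists C.
rewrite -/B /inv_norm; case: pselect => [H|]; last by case; exists C.
case: (cid H) => C' [_ BC'] /=; rewrite inver; case: eqVneq => [_|C0].
  by rewrite leye_eq.
apply/negP; rewrite lee_fin -ltNge; apply: lt_le_trans em _.
rewrite -[m]invrK lef_pV2 ?posrE ?invr_gt0//; last by rewrite lt_neqAle eq_sym C0 nrm_ge0.
apply: nrm_bop_ub => [|y]; first by rewrite invr_ge0 ltW.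
by rewrite ler_pdivlMl// -{2}(BC' y).
Qed.

Lemma le_lower_normP U V (f : U -> V) m : (forall c x, f (c *: x) = c *: f x) ->
  (m%:E <= lower_norm setT f)%E <-> bounded_below m f.
Proof.
move=> fZ; split=> [/ereal_infP h x|h].
  have [->|x0] := eqVneq x 0; first by rewrite nrm0 mulr0 nrm_ge0.
  have xp : 0 < nrm x by rewrite nrm_gt0.
  have := h (nrm (f ((nrm x)^-1%:C *: x)))%:E => /(_ _)/wrap[].
    exists ((nrm x)^-1%:C *: x) => //; split=> //=.
    by rewrite nrmZ nrm_real gtr0_norm ?invr_gt0// mulVf ?gt_eqF.
  rewrite lee_fin fZ nrmZ nrm_real gtr0_norm ?invr_gt0// mulrC => h'.
  by rewrite -ler_pdivlMr.
apply/ereal_infP => _ [x [_ /= x1] <-]; rewrite lee_fin.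
by have := h x; rewrite x1 mulr1.
Qed.

Lemma le_lower_norm U V (S : set U) (f : U -> V) m :
  bounded_below m f -> (m%:E <= lower_norm S f)%E.
Proof.
move=> h; apply/ereal_infP => _ [x [_ /= x1] <-]; rewrite lee_fin.
by have := h x; rewrite x1 mulr1.
Qed.

Lemma opnorm_leP U V (f : U -> V) c : (forall k x, f (k *: x) = k *: f x) ->
  (opnorm f <= c%:E)%E -> forall x, nrm (f x) <= c * nrm x.
Proof.
move=> fZ fc x; have [->|x0] := eqVneq x 0.
  by have := fZ 0 0; rewrite !scale0r => ->; rewrite !nrm0 mulr0.
have xp : 0 < nrm x by rewrite nrm_gt0.
have : ((nrm (f ((nrm x)^-1%:C *: x)))%:E <= c%:E)%E.
  apply: le_trans fc; apply: ereal_sup_ubound; exists ((nrm x)^-1%:C *: x) => //=.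
  by rewrite nrmZ nrm_real gtr0_norm ?invr_gt0// mulVf ?gt_eqF.
by rewrite lee_fin fZ nrmZ nrm_real gtr0_norm ?invr_gt0// ler_pdivrMl// mulrC.
Qed.

Lemma le_bigmine (I : eqType) (s : seq I) (F : I -> \bar R) m :
  (m <= \big[mine/+oo]_(k <- s) F k)%E <-> forall k, k \in s -> (m <= F k)%E.
Proof.
elim: s => [|i s IH]; first by rewrite big_nil leey.
rewrite big_cons le_min; split=> [/andP[mi /IH ms] k|h].
  by rewrite inE => /predU1P[->//|]; exact: ms.
apply/andP; split; first by apply: h; rewrite inE eqxx.
by apply/IH => k ks; apply: h; rewrite inE ks orbT.
Qed.

Lemma lte_fin_between (c : R) (y : \bar R) :
  (c%:E < y)%E -> exists2 m, c < m & (m%:E <= y)%E.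
Proof.
case: y => [r||//]; first by rewrite lte_fin => cr; exists r.
by exists (c + 1); [rewrite ltrDl|exact: leey].
Qed.

Section Matrices.
Variable Y : normedModType R[i].

Lemma mxactZ m n (M : 'M[bop Y Y]_(m, n)) c x : mxact M (c *: x) = c *: mxact M x.
Proof.
apply: ell2_eq => r; rewrite ell2_scaleE /= scaler_sumr.
by apply: eq_bigr => j _; rewrite -bopZ.
Qed.

Lemma mxactB m n (M N : 'M[bop Y Y]_(m, n)) x : mxact (M - N) x = mxact M x - mxact N x.
Proof.
apply: ell2_eq => r; rewrite ell2_subE /= -sumrB.
by apply: eq_bigr => j _; rewrite !mxE.
Qed.

Lemma bounded_below_mxact_perturb m n (M N : 'M[bop Y Y]_(m, n)) mu d :
  bounded_below mu (mxact M) -> (opnorm (mxact (N - M)) <= d%:E)%E ->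
  bounded_below (mu - d) (mxact N).
Proof.
move=> hM hd z.
have := opnorm_leP (mxactZ (N - M)) hd z; rewrite mxactB => dz.
rewrite mulrBl lerBlDr; apply: le_trans (hM z) _.
rewrite -lerBlDl; apply: le_trans dz; rewrite nrm_distC; exact: nrm_subr.
Qed.

End Matrices.
End LowerBounds.

Section Inclusions.
Variables (R : realType) (X : normedModType R[i]).
Variables (A : bop (ell2 int X) (ell2 int X)) (a : int -> int -> bop X X).
Hypothesis hA : tridiagonal A a.

(** This makes [alpha_inf] and [gamma_inf] suprema of bounded sets, so that they do dominate the
    entries. *)
Lemma tridiagonal_entry_le i j : nrm (a i j) <= nrm A.
Proof.
apply: nrm_bop_ub (nrm_ge0 _) _ => u; have [a0 _] := hA.
have [ij|ij] := leP `|i - j| 1; last by rewrite a0// bop_zeroE nrm0 mulr_ge0 ?nrm_ge0.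
have : a i j u = A (ell2_single j u) i.
  rewrite (tridiagonal_single _ _ hA) ell2_sumE (@big_seq_pred1 _ _ _ i).
  - by rewrite ell2_singleE eqxx.
  - exact: near_diag_uniq.
  - by rewrite mem_near_diag distrC.
  - by move=> r ri; rewrite ell2_singleE eq_sym (negbTE ri).
move=> ->; apply: le_trans (ell2_coord_le _ _) _; apply: le_trans (nrm_bop_le _ _) _.
by rewrite nrm_ell2_single.
Qed.

Lemma alpha_inf_ge j : nrm (a (j + 1) j) <= alpha_inf a.
Proof.
apply: ub_le_sup; last by exists j.
by exists (nrm A) => _ [i _ <-]; exact: tridiagonal_entry_le.
Qed.

Lemma gamma_inf_ge j : nrm (a (j - 1) j) <= gamma_inf a.
Proof.
apply: ub_le_sup; last by exists j.
by exists (nrm A) => _ [i _ <-]; exact: tridiagonal_entry_le.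
Qed.

Lemma mu_fin_shift n (K : {fset int}) (l : R[i]) :
  mu_fin n K (A - l *: bop_id _) =
  \big[mine/+oo%E]_(k <- K)
     mine (lower_norm setT (mxact (plusmx (shiftmx a l) n k)))
          (lower_norm setT (mxact (plusmx (adjmx (shiftmx a l)) n k))).
Proof.
have hB := tridiagonal_shiftmx l hA.
by apply: eq_bigr => k _; rewrite (lower_norm_En _ _ hB) (lower_norm_En_dual _ _ hB).
Qed.

Lemma mu_fin_plusmx n (K : {fset int}) (l : R[i]) :
  mu_fin n K (A - l *: bop_id _) =
  \big[mine/+oo%E]_(k <- K)
    mine (lower_norm setT (mxact (plusmx a n k - scaled_Iplus X n l)))
         (lower_norm setT (mxact (plusmx (adjmx a) n k - scaled_Iplus (dual X) n l))).
Proof.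
rewrite mu_fin_shift; apply: eq_bigr => k _.
by rewrite adjmx_shiftmx !plusmx_shiftmx.
Qed.

Lemma le_mu_fin n (K : {fset int}) B m :
  both_below m B -> (m%:E <= @mu_fin R X n K B)%E.
Proof.
move=> [hB hBa]; apply/le_bigmine => k _; rewrite le_min.
by rewrite !le_lower_norm.
Qed.

Lemma mu_fin_lower_bound n (K : {fset int}) (l : R[i]) m : (0 < n)%N -> covers a n K ->
  (m%:E <= mu_fin n K (A - l *: bop_id _)%R)%E ->
  both_below (m - n%:R^-1 - eps_pp a n) (A - l *: bop_id _).
Proof.
move=> n0 hK; rewrite mu_fin_shift => /le_bigmine hm.
set b := shiftmx a l in hm; have hB : tridiagonal (A - l *: bop_id _) b.
  exact: tridiagonal_shiftmx.
have [b0 BE] := hB; have b0' := adjmx_tridiagonal b0.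
have hmk k : bounded_below (m - n%:R^-1) (mxact (plusmx b n k)) /\
    bounded_below (m - n%:R^-1) (mxact (plusmx (adjmx b) n k)).
  have [j jK [d1 d2]] := hK k.
  have := hm j jK; rewrite le_min => /andP[].
  move=> /(le_lower_normP _ (mxactZ _)) h1 /(le_lower_normP _ (mxactZ _)) h2.
  split.
    (* The multiples of [I^+_n] cancel in the difference of two sections, so a cover for [a] serves
       every [l]. *)
    apply: bounded_below_mxact_perturb h1 _.
    by rewrite /b !plusmx_shiftmx opprB addrA subrK.
  apply: bounded_below_mxact_perturb h2 _.
  by rewrite /b adjmx_shiftmx !plusmx_shiftmx opprB addrA subrK.
have ha j : nrm (b (j + 1) j) <= alpha_inf a by rewrite /b shiftmx_next alpha_inf_ge.
have hg j : nrm (b (j - 1) j) <= gamma_inf a by rewrite /b shiftmx_prev gamma_inf_ge.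
set B := A - _ in hB BE *; split=> [x|phi]; rewrite mulrBl lerBlDr.
  by have := window_lower_bound b0 ha hg (BE x) n0 (fun k => (hmk k).1).
(* Transposition exchanges the two off-diagonals; [eps_pp] is symmetric in them. *)
have ha' j : nrm (adjmx b (j + 1) j) <= gamma_inf a.
  by apply: le_trans (nrm_adjoint _) _; have := hg (j + 1); rewrite addrK.
have hg' j : nrm (adjmx b (j - 1) j) <= alpha_inf a.
  by apply: le_trans (nrm_adjoint _) _; have := ha (j - 1); rewrite subrK.
have BE' i := dual_ell2_adjoint phi i hB.
have := window_lower_bound b0' ha' hg' BE' n0 (fun k => (hmk k).2).
by rewrite !nrm_dual_ell2 /eps_pp [gamma_inf a + _]addrC.
Qed.

Hypothesis cX : nrm_complete X.

Lemma Gamma_fin_subset_Spec_eps n (K : {fset int}) eps : 0 <= eps ->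
  Gamma_fin n K eps A `<=` Spec_eps eps A.
Proof.
move=> eps0 l /= hl; apply: contrapT => /(Spec_epsP _ _ (ell2_complete cX) eps0)[m em hB].
have := le_trans (le_mu_fin n K hB) hl; rewrite lee_fin leNgt em//.
Qed.

Lemma Spec_eps_subset_Gamma_fin n (K : {fset int}) eps : 0 <= eps -> (0 < n)%N ->
  covers a n K ->
  Spec_eps eps A `<=` Gamma_fin n K (eps + eps_pp a n + n%:R^-1) A.
Proof.
move=> eps0 n0 hK l hl; rewrite /Gamma_fin /= leNgt; apply/negP.
move=> /lte_fin_between[m cm /(mu_fin_lower_bound n0 hK) hm].
apply/(Spec_epsP _ _ (ell2_complete cX) eps0) : hl; exists (m - n%:R^-1 - eps_pp a n) => //.
by rewrite -addrA -opprD ltrBrDr [n%:R^-1 + _]addrC addrA.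
Qed.

End Inclusions.

(** * Non-emptiness of the spectrum *)

Section RootsOfUnity.

(** [X^n - 1] is separable in characteristic zero, so it has [n] distinct roots, and a full set of
    [n]-th roots of unity contains a primitive one. *)
Lemma prim_root_closedField (F : numClosedFieldType) n :
  (0 < n)%N -> exists z : F, n.-primitive_root z.
Proof.
move=> n0; have [r rE] := closed_field_poly_normal ('X^n - 1 : {poly F}).
have mon : ('X^n - 1 : {poly F}) \is monic by rewrite -[1]polyC1 monicXnsubC.
rewrite (monicP mon) scale1r in rE.
have unit_r : all n.-unity_root r by apply/allP => z; rewrite -root_prod_XsubC -rE.
have uniq_r : uniq r.
  by rewrite -separable_prod_XsubC -rE separable_Xn_sub_1// pnatr_eq0 -lt0n.
have size_r : (n <= size r)%N.
  by have := congr1 (fun p : {poly F} => size p) rE; rewrite size_prod_XsubC size_XnsubC// => -[->].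
by have /hasP[z _ hz] := has_prim_root n0 unit_r uniq_r size_r; exists z.
Qed.

Lemma sum_prim_root (F : fieldType) n (z : F) k : n.-primitive_root z ->
  (0 < k < n)%N -> \sum_(j < n) z ^+ (j * k) = 0.
Proof.
move=> hz /andP[k0 kn]; have zk : z ^+ k - 1 != 0.
  by rewrite subr_eq0 -(prim_order_dvd hz) gtnNdvd.
apply: (mulfI zk); rewrite mulr0; transitivity ((z ^+ k) ^+ n - 1); last first.
  by rewrite -exprM mulnC exprM (prim_expr_order hz) expr1n subrr.
by rewrite [RHS]subrX1; congr (_ * _); apply: eq_bigr => j _; rewrite mulnC exprM.
Qed.

End RootsOfUnity.

Section Geometry.
Variable R : realType.

(** With [p] the square root of [q], one factor [p ^ n] keeps [n * p ^ n] bounded by [1 / (1 - p)]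
    and the other tends to zero. *)
Lemma natmul_expr_small (q e : R) : 0 <= q < 1 -> 0 < e ->
  exists2 n, (0 < n)%N & n%:R * q ^+ n <= e.
Proof.
move=> /andP[q0 q1] e0; set p := Num.sqrt q.
have p0 : 0 <= p by exact: sqrtr_ge0.
have p1 : p < 1 by rewrite -sqrtr1 ltr_sqrt.
have bnd n : n%:R * p ^+ n * (1 - p) <= 1.
  apply: (@le_trans _ _ (1 - p ^+ n)); last by rewrite lerBlDr lerDl exprn_ge0.
  elim: n => [|n IH]; first by rewrite !mul0r expr0 subrr.
  have pn0 : 0 <= p ^+ n by rewrite exprn_ge0.
  rewrite exprS -natr1.
  have : 0 <= (1 - p) * (1 - p ^+ n).
    by rewrite mulr_ge0 ?subr_ge0 ?(ltW p1)// exprn_ile1// ltW.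
  have : p * (n%:R * p ^+ n * (1 - p)) <= p * (1 - p ^+ n) by rewrite ler_wpM2l.
  have := mulr_ge0 pn0 (sqr_ge0 (1 - p)).
  lra.
have d0 : 0 < e * (1 - p) by rewrite mulr_gt0 ?subr_gt0.
have : p ^+ n @[n --> \oo] --> 0 by apply: cvg_expr; rewrite ger0_norm.
move=> /cvgrPdist_le/(_ _ d0)[N _ /(_ N.+1 (leqnSn N))].
rewrite /= sub0r normrN ger0_norm ?exprn_ge0// => hN; exists N.+1 => //.
have -> : q = p ^+ 2 by rewrite sqr_sqrtr.
rewrite -exprM mul2n -addnn exprD mulrA.
have p1' : 0 < 1 - p by rewrite subr_gt0.
have h := bnd N.+1; rewrite -ler_pdivlMr// mul1r in h.
apply: le_trans (ler_wpM2r (exprn_ge0 _ p0) h) _.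
by rewrite ler_pdivrMl// mulrC.
Qed.

Lemma exists_invS_le (e : R) : 0 < e -> exists N : nat, N.+1%:R^-1 <= e.
Proof.
move=> e0; have [N hN] := ltr_add_invr e0; exists N.
by move: hN; rewrite add0r => /ltW.
Qed.

Lemma bounded_cluster (z : nat -> R[i]) M : (forall n, nrm (z n) <= M) ->
  exists w, forall e N, 0 < e -> exists2 n, (N <= n)%N & nrm (z n - w) <= e.
Proof.
move=> zM; pose f n := (complex.Re (z n), complex.Im (z n)).
have cK : compact (`[- M, M]%classic `*` `[- M, M]%classic : set (R * R)).
  by apply: compact_setX; exact: segment_compact.
have fK : (f @ \oo) (`[- M, M]%classic `*` `[- M, M]%classic).
  exists 0%N => // n _ /=; rewrite !in_itv/= -!ler_norml.
  by split; apply: le_trans (zM n); rewrite ?Re_le_nrm ?Im_le_nrm.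
have [[a b] [_ clab]] := cK (f @ \oo) _ fK; exists (a +i* b)%C => e N e0.
have e20 : 0 < e / 2 by rewrite divr_gt0.
have tail : (f @ \oo) [set f n | n in [set n | (N <= n)%N]].
  by exists N => // n /= Nn; exists n.
have near_ab : nbhs (a, b) (ball (a, b) (e / 2)) by exact: nbhsx_ballx.
have [_ [[n /= Nn <-] [/= ba bb]]] := clab _ _ tail near_ab; exists n => //.
apply: le_trans (nrm_le_ReIm _) _; rewrite [leRHS]splitr.
move: ba bb; rewrite /ball/= => ba bb.
have -> : complex.Re (z n - (a +i* b)%C) = complex.Re (z n) - a by case: (z n).
have -> : complex.Im (z n - (a +i* b)%C) = complex.Im (z n) - b by case: (z n).
by rewrite lerD// distrC ltW.
Qed.

End Geometry.

(** * The best common lower bound as a function of the spectral parameter *)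

Section LowerBoundFunction.
Variables (R : realType) (U : normedModType R[i]).
Implicit Types (l h : R[i]).

Lemma adjoint_shift (A : bop U U) l (phi : dual U) :
  adjoint (A - l *: bop_id U) phi = adjoint A phi - l *: phi.
Proof. by apply: bopE => u; rewrite /= bopB bopZ. Qed.

Lemma both_below_shift (A : bop U U) l l' m : both_below m (A - l *: bop_id U) ->
  both_below (m - nrm (l - l')) (A - l' *: bop_id U).
Proof.
move=> [h1 h2]; split=> [x|phi]; rewrite mulrBl lerBlDr.
  apply: le_trans (h1 x) _; rewrite -nrmZ.
  have -> : (A - l *: bop_id U) x = (A - l' *: bop_id U) x - (l - l') *: x.
    by rewrite !bop_subE !bop_scaleE scalerBl opprB addrA subrK.
  exact: nrmB.
apply: le_trans (h2 phi) _; rewrite !adjoint_shift -nrmZ.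
have -> : adjoint A phi - l *: phi = adjoint A phi - l' *: phi - (l - l') *: phi.
  by rewrite scalerBl opprB addrA subrK.
exact: nrmB.
Qed.

Lemma both_below_far (A : bop U U) l : both_below (nrm l - nrm A) (A - l *: bop_id U).
Proof.
split=> [x|phi]; rewrite mulrBl -nrmZ.
  apply: le_trans (lerB (lexx _) (nrm_bop_le A x)) _.
  rewrite bop_subE bop_scaleE nrm_distC; exact: nrm_subr.
rewrite adjoint_shift; apply: (@le_trans _ _ (nrm (l *: phi) - nrm (adjoint A phi))).
  rewrite lerB//; apply: le_trans (nrm_bop_le _ _) _.
  by rewrite ler_wpM2r ?nrm_ge0 ?nrm_adjoint.
by rewrite nrm_distC; exact: nrm_subr.
Qed.

Variables (A : bop U U) (x0 : U).
Hypothesis x0N0 : x0 != 0.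

Definition lower_bound l : R := sup [set m | both_below m (A - l *: bop_id U)].

(** The nonzero vector [x0] bounds the set from above; on the trivial space every [m] would be a
    lower bound. *)
Lemma both_below_sup l : has_sup [set m | both_below m (A - l *: bop_id U)].
Proof.
split; first by exists (nrm l - nrm A); exact: both_below_far.
exists (nrm (A - l *: bop_id U)) => m [/(_ x0) hm _].
have := le_trans hm (nrm_bop_le _ _).
by rewrite ler_pM2r// nrm_gt0.
Qed.

(** The supremum is attained because, for each vector and each functional, the condition on [m] is
    closed. *)
Lemma both_belowP l m : both_below m (A - l *: bop_id U) <-> m <= lower_bound l.
Proof.
split=> [hm|hm]; first by apply: ub_le_sup => //; case: (both_below_sup l).
suff h : both_below (lower_bound l) (A - l *: bop_id U).
  by split=> x; [apply: le_trans (h.1 x)|apply: le_trans (h.2 x)];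
    rewrite ler_wpM2r ?nrm_ge0.
have hs := both_below_sup l.
have key (V : normedModType R[i]) (f : V -> V) :
    (forall m, both_below m (A - l *: bop_id U) -> bounded_below m f) ->
    bounded_below (lower_bound l) f.
  move=> hf x; have [->|xN0] := eqVneq x 0; first by rewrite nrm0 mulr0 nrm_ge0.
  rewrite -ler_pdivlMr ?nrm_gt0//; apply: ge_sup; first by case: hs.
  by move=> t /hf ht; rewrite ler_pdivlMr ?nrm_gt0.
by split; apply: key => t [].
Qed.

Lemma lower_bound_lipschitz l l' : lower_bound l - nrm (l - l') <= lower_bound l'.
Proof. by apply/both_belowP/both_below_shift/both_belowP. Qed.

Lemma lower_bound_far l : nrm l - nrm A <= lower_bound l.
Proof. exact/both_belowP/both_below_far. Qed.

Hypothesis cU : nrm_complete U.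

Lemma Spec_eps_lower_bound eps l : 0 <= eps -> Spec_eps eps A l <-> lower_bound l <= eps.
Proof.
move=> eps0; split=> h.
  rewrite leNgt; apply/negP => lt.
  by apply/(Spec_epsP A l cU eps0) : h; exists (lower_bound l) => //; exact/both_belowP.
apply: contrapT => /(Spec_epsP A l cU eps0)[m em /both_belowP hm].
by have := lt_le_trans em (le_trans hm h); rewrite ltxx.
Qed.

End LowerBoundFunction.

Section SpectrumNonempty.
Variables (R : realType) (U : normedModType R[i]).
Implicit Types (B C : bop U U) (l h mu : R[i]) (u v x : U).

Lemma iter_bopD C n u v : iter n C (u + v) = iter n C u + iter n C v.
Proof. by elim: n => //= n ->; rewrite bopD. Qed.

Lemma iter_bopZ C n (c : R[i]) u : iter n C (c *: u) = c *: iter n C u.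
Proof. by elim: n => //= n ->; rewrite bopZ. Qed.

Lemma iter_bop_sum C n (I : Type) (s : seq I) (F : I -> U) :
  iter n C (\sum_(i <- s) F i) = \sum_(i <- s) iter n C (F i).
Proof.
elim: s => [|i s IH]; last by rewrite !big_cons iter_bopD IH.
by rewrite !big_nil; elim: n => //= n ->; rewrite bop0.
Qed.

Lemma nrm_iter_bop C n u : nrm (iter n C u) <= nrm C ^+ n * nrm u.
Proof.
elim: n => [|n IH]; first by rewrite expr0 mul1r.
apply: le_trans (nrm_bop_le _ _) _; rewrite exprS -mulrA.
by rewrite ler_wpM2l ?nrm_ge0.
Qed.

(** A finite Neumann expansion with exact remainder, obtained by iterating [v = C x + mu *: C v]; it
    needs no smallness of [mu]. *)
Lemma resolvent_expansion B C mu v x n : is_inverse B C -> B v - mu *: v = x ->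
  v = \sum_(k < n) mu ^+ k *: iter k.+1 C x + mu ^+ n *: iter n C v.
Proof.
move=> [CB _] vx; have vE : v = C x + mu *: C v.
  by rewrite -vx bopB bopZ CB subrK.
elim: n => [|n IH]; first by rewrite big_ord0 add0r expr0 scale1r.
rewrite {1}IH big_ord_recr/= -addrA; congr (_ + _).
rewrite {1}vE iter_bopD scalerDr iter_bopZ scalerA -exprSr.
by rewrite -!iterSr !iterS.
Qed.

(* Averaging the expansions over the [n]-th roots of unity kills all powers of
   [h] but the multiples of [n]. *)
Lemma resolvent_average B C h (z : R[i]) n (v : nat -> U) x :
  is_inverse B C -> n.-primitive_root z ->
  (forall j, B (v j) - (h * z ^+ j) *: v j = x) ->
  n%:R *: C x = \sum_(j < n) v j - h ^+ n *: iter n C (\sum_(j < n) v j).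
Proof.
move=> hC hz hv; have n0 := prim_order_gt0 hz; apply/eqP; rewrite eq_sym subr_eq; apply/eqP.
rewrite {1}(eq_bigr (fun j : 'I_n => \sum_(k < n) (h * z ^+ j) ^+ k *: iter k.+1 C x
  + h ^+ n *: iter n C (v j))); last first.
  move=> j _; rewrite {1}(resolvent_expansion n hC (hv j)); congr (_ + _ *: _).
  by rewrite exprMn -exprM mulnC exprM (prim_expr_order hz) expr1n mulr1.
rewrite big_split/= iter_bop_sum scaler_sumr; congr (_ + _).
rewrite exchange_big/=; case: n n0 hz {hv} => // n _ hz.
rewrite big_ord_recl/= [X in _ + X]big1 ?addr0 => [|k _].
  under eq_bigr do rewrite expr0.
  by rewrite -scaler_suml sumr_const card_ord.
rewrite -scaler_suml; under eq_bigr do rewrite exprMn -exprM.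
by rewrite -mulr_sumr (sum_prim_root hz) ?mulr0 ?scale0r// /bump leq0n/= ltnS.
Qed.

Variable A : bop U U.

(* If [M] bounds the norm of all the resolvents and is attained at [w], then
   averaging over [w + h z ^ j] shows that it is attained at [w + h] too. *)
Lemma resolvent_max_principle (M : R) w h C0 Ch : 0 < M ->
  (forall l, exists2 C, is_inverse (A - l *: bop_id U) C & nrm C <= M) ->
  is_inverse (A - w *: bop_id U) C0 -> M <= nrm C0 ->
  is_inverse (A - (w + h) *: bop_id U) Ch -> nrm h * M < 1 -> M <= nrm Ch.
Proof.
move=> M0 hM hC0 nC0 hCh hq; set q := nrm h * M.
have q01 : 0 <= q < 1 by rewrite hq mulr_ge0 ?nrm_ge0// ltW.
have C0M : nrm C0 <= M.
  have [C [CB BC] nC] := hM w; have [C0B BC0] := hC0.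
  suff -> : C0 = C by [].
  by apply: bopE => x; rewrite -{1}(BC x) C0B.
apply/ler_addgt0Pr => e e0.
(* This [n] makes the averaged remainder, at most [n * q ^ n * M], smaller than [e]. *)
have [n n0 hn] := natmul_expr_small q01 (divr_gt0 e0 M0).
have [z hz] := @prim_root_closedField R[i] n n0.
have bnd x : n%:R * nrm (C0 x) <= ((n%:R - 1) * M + nrm Ch + n%:R * q ^+ n * M) * nrm x.
  (* Only [j = 0] lands on [w + h], where [Ch] supplies the bound; the other [n - 1] points use [M].
     In the end [n * M] is compared with [(n - 1) * M + nrm Ch + e]. *)
  have /choice[v hv] : forall j, exists v, (A - w *: bop_id U) v - (h * z ^+ j) *: v = x
      /\ nrm v <= (if j == 0%N then nrm Ch else M) * nrm x.
    have shift mu v : (A - w *: bop_id U) v - mu *: v = (A - (w + mu) *: bop_id U) v.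
      by rewrite !bop_subE !bop_scaleE scalerDl opprD addrA.
    move=> j; case: eqP => [->|_].
      by exists (Ch x); rewrite shift expr0 mulr1 hCh.2; split=> //; exact: nrm_bop_le.
    have [C hC nC] := hM (w + h * z ^+ j); exists (C x); rewrite shift hC.2; split=> //.
    by apply: le_trans (nrm_bop_le _ _) _; rewrite ler_wpM2r ?nrm_ge0.
  have vM j : nrm (v j) <= M * nrm x.
    have [C [CB _] nC] := hM (w + h * z ^+ j).
    have -> : v j = C x.
      by rewrite -[LHS]CB bop_subE bop_scaleE scalerDl opprD addrA (hv j).1.
    by apply: le_trans (nrm_bop_le _ _) _; rewrite ler_wpM2r ?nrm_ge0.
  have sumv : nrm (\sum_(j < n) v j) <= n%:R * (M * nrm x).
    apply: le_trans (nrm_sum _ _ _) _.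
    apply: (@le_trans _ _ (\sum_(j < n) M * nrm x)); first exact: ler_sum.
    by rewrite sumr_const card_ord mulr_natl.
  have sumv' : nrm (\sum_(j < n) v j) <= ((n%:R - 1) * M + nrm Ch) * nrm x.
    apply: le_trans (nrm_sum _ _ _) _.
    have -> : n%:R - 1 = n.-1%:R :> R by rewrite -{1}(prednK n0) -natr1 addrK.
    case: n n0 {hn hz sumv} => // n _ /=.
    rewrite big_ord_recl addrC mulrDl lerD//; last exact: (hv 0%N).2.
    apply: (@le_trans _ _ (\sum_(j < n) M * nrm x)); first exact: ler_sum.
    by rewrite sumr_const card_ord -[leLHS]mulr_natl mulrA.
  have := resolvent_average hC0 hz (fun j => (hv j).1).
  move=> /(congr1 (@nrm _ _)); rewrite nrmZ -[n%:R in LHS]/((1 *+ n) : R[i]).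
  have -> : nrm (n%:R : R[i]) = n%:R :> R.
    by rewrite -[n%:R in LHS](rmorph_nat (@real_complex R)) nrm_real ger0_norm.
  move=> ->; apply: le_trans (nrmB _ _) _; rewrite mulrDl lerD//.
  rewrite nrmZ nrmX; apply: le_trans (ler_wpM2l (exprn_ge0 _ (nrm_ge0 _)) (nrm_iter_bop _ _ _)) _.
  rewrite mulrA -exprMn.
  have qn : (nrm h * nrm C0) ^+ n <= q ^+ n.
    by rewrite lerXn2r ?nnegrE ?mulr_ge0 ?nrm_ge0 ?(ltW M0)// ler_wpM2l ?nrm_ge0.
  apply: le_trans (ler_pM _ _ qn sumv) _; rewrite ?exprn_ge0 ?mulr_ge0 ?nrm_ge0//.
  by rewrite le_eqVlt; apply/orP; left; apply/eqP; ring.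
have n0' : 0 < n%:R :> R by rewrite ltr0n.
have : n%:R * nrm C0 <= (n%:R - 1) * M + nrm Ch + n%:R * q ^+ n * M.
  rewrite -ler_pdivlMl//; apply: nrm_bop_ub => [|x].
    rewrite mulr_ge0 ?invr_ge0 ?(ltW n0')// !addr_ge0 ?nrm_ge0 ?mulr_ge0 ?exprn_ge0//.
    - by rewrite subr_ge0 ler1n.
    - exact: ltW.
    - by case/andP: q01.
    - exact: ltW.
  by rewrite -[leRHS]mulrA ler_pdivlMl.
have : n%:R * M <= n%:R * nrm C0 by rewrite ler_wpM2l// ltW.
move: hn; rewrite ler_pdivlMr// => hn h1 h2.
have := le_trans h1 h2; lra.
Qed.

Variable x0 : U.
Hypothesis x0N0 : x0 != 0.
Hypothesis cU : nrm_complete U.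

Local Notation g := (lower_bound A).

(** A minimising sequence is bounded since [g] grows like the norm of [l]; at a cluster point the
    Lipschitz bound gives the minimum. *)
Lemma lower_bound_attains_min : exists w, forall l, g w <= g l.
Proof.
have glb : has_inf (range g).
  split; first by exists (g 0), 0.
  exists (- nrm A) => _ [l _ <-]; apply: le_trans (lower_bound_far A x0N0 l).
  by rewrite lerDr nrm_ge0.
have /choice[z hz] : forall n : nat, exists z, g z <= inf (range g) + n.+1%:R^-1.
  move=> n; have n0 : 0 < n.+1%:R^-1 :> R by rewrite invr_gt0.
  by have [_ [l _ <-] lt] := inf_adherent n0 glb; exists l; exact: ltW.
have zM n : nrm (z n) <= inf (range g) + 1 + nrm A.
  rewrite -lerBlDr; apply: le_trans (lower_bound_far A x0N0 (z n)) _.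
  by apply: le_trans (hz n) _; rewrite lerD2l invf_le1// ler1n.
have [w hw] := bounded_cluster zM; exists w => l.
have gl : inf (range g) <= g l by apply: ge_inf; [case: glb|exists l].
apply: le_trans gl; apply/ler_addgt0Pr => e e0.
have e20 : 0 < e / 2 by rewrite divr_gt0.
have [N hN] := exists_invS_le e20.
have [n Nn zw] := hw _ N e20.
have := lower_bound_lipschitz A x0N0 w (z n); rewrite lerBlDr => /le_trans; apply.
rewrite [e]splitr addrA lerD//; last by rewrite nrm_distC.
apply: le_trans (hz n) _; rewrite lerD2l; apply: le_trans hN.
by rewrite lef_pV2 ?posrE// ler_nat ltnS.
Qed.

Lemma Spec_nonempty : exists l, Spec A l.
Proof.
apply: contrapT => /forallNP noSpec.
have g0 l : 0 < g l.
  rewrite ltNge; apply/negP => /(Spec_eps_lower_bound A x0N0 cU l (lexx 0)).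
  by rewrite /Spec_eps eqxx; exact: noSpec.
have [w hw] := lower_bound_attains_min.
have [m gw] : exists m, g w = m by exists (g w).
have m0 : 0 < m by rewrite -gw.
have {}hw l : m <= g l by rewrite -gw.
have M0 : 0 < m^-1 by rewrite invr_gt0.
have inv t l : 0 < t -> t <= g l ->
    exists2 C, is_inverse (A - l *: bop_id U) C & nrm C <= t^-1.
  move=> t0 /(both_belowP A x0N0)[h1 h2]; exact: (bounded_below_adjoint_invertible cU t0 h1 h2).
have hM l : exists2 C, is_inverse (A - l *: bop_id U) C & nrm C <= m^-1.
  exact: (inv m l m0 (hw l)).
have max_g l C : is_inverse (A - l *: bop_id U) C -> m^-1 <= nrm C -> g l = m.
  move=> [CB BC] hC; apply/le_anti/andP; split; last exact: hw.
  have [C' [C'B BC'] nC'] := inv _ l (g0 l) (lexx _).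
  have e : C = C' by apply: bopE => x; rewrite -{1}(BC' x) CB.
  by rewrite -lef_pV2 ?posrE//; apply: le_trans hC _; rewrite e.
have g_max l C : is_inverse (A - l *: bop_id U) C -> g l = m -> m^-1 <= nrm C.
  move=> hC gl; rewrite leNgt; apply/negP => lt.
  have [s sE] : exists s, m * nrm C = s by exists (m * nrm C).
  have s1 : s < 1 by rewrite -sE -ltr_pdivlMl// mulr1.
  have s0 : 0 <= s by rewrite -sE mulr_ge0 ?nrm_ge0 ?ltW.
  have s2 : 0 < 1 + s by rewrite ltr_wpDr.
  (* Since [s < 1], this bound exceeds [m], while its product with [nrm C] is [2 s / (1 + s) <= 1];
     it avoids dividing by [nrm C]. *)
  have : m * 2 / (1 + s) <= g l.
    apply/(both_belowP A x0N0); apply: inverse_bounded_below hC _ _.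
      by rewrite divr_ge0 ?mulr_ge0 ?ltW.
    by rewrite mulrAC ler_pdivrMr// mul1r mulrAC sE mulr_natr mulr2n lerD2r ltW.
  by rewrite gl leNgt ltr_pdivlMr// ltr_pM2l// [1 + s]addrC -[2]/(1 + 1) ltrD2r s1.
(* A step of length [m / 2] gives [nrm h * M = 1 / 2], within reach of the maximum principle. *)
have step l : g l = m -> g (l + (m / 2)%:C) = m.
  move=> gl; have [C0 hC0 _] := hM l; have [Ch hCh _] := hM (l + (m / 2)%:C).
  apply: (max_g _ _ hCh); apply: (resolvent_max_principle M0 hM hC0 (g_max _ _ hC0 gl) hCh).
  rewrite nrm_real ger0_norm ?divr_ge0 ?ltW// mulrAC mulfV ?gt_eqF// mul1r.
  by rewrite invf_lt1// ltr1n.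
(* Walking parallel to the real axis keeps [g] equal to [m], against [g l >= nrm l - nrm A]; [c]
   below counts the steps that suffice. *)
have walk k : g (w + (k%:R * (m / 2))%:C) = m.
  elim: k => [|k IH]; first by rewrite mul0r addr0.
  have -> : k.+1%:R * (m / 2) = k%:R * (m / 2) + m / 2.
    by rewrite -[k.+1]addn1 natrD mulrDl mul1r.
  by rewrite rmorphD/= addrA step.
pose c := (m + nrm A + nrm w) / (m / 2).
have m20 : 0 < m / 2 by rewrite divr_gt0.
have [k hk] : exists k : nat, c < k%:R.
  exists (Num.bound c); apply: archi_boundP.
  by rewrite divr_ge0 ?addr_ge0 ?nrm_ge0 ?(ltW m0) ?(ltW m20).
have := lower_bound_far A x0N0 (w + (k%:R * (m / 2))%:C); rewrite walk leNgt => /negP; apply.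
rewrite ltrBrDr; move: hk; rewrite ltr_pdivrMr// => hk.
have := nrm_subr ((k%:R * (m / 2))%:C : R[i]) (- w); rewrite opprK [_%:C + _]addrC nrmN.
rewrite nrm_real ger0_norm => [h|]; last by rewrite mulr_ge0 ?(ltW m20).
by apply: lt_le_trans h; rewrite ltrBrDr.
Qed.

End SpectrumNonempty.

(** * Hausdorff convergence and finite covers *)

Section HausdorffConvergence.
Variables (R : realType) (U : normedModType R[i]) (A : bop U U) (x0 : U).
Hypotheses (x0N0 : x0 != 0) (cU : nrm_complete U).

(** Otherwise some points stay farther than [rho] from the [eps]-sublevel set while their values of
    [g] drop to [eps] in the limit. They are bounded, and a cluster point lies in that set by
    continuity of [g]. *)
Lemma Spec_eps_upper_semicontinuous eps rho : 0 <= eps -> 0 < rho ->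
  exists2 d, 0 < d & forall e, 0 <= e <= d -> forall l, Spec_eps (eps + e) A l ->
    exists2 t, Spec_eps eps A t & nrm (l - t) <= rho.
Proof.
move=> eps0 rho0; apply: contrapT => far.
have /choice[z hz] : forall n : nat, exists l, lower_bound A l <= eps + n.+1%:R^-1 /\
    forall t, Spec_eps eps A t -> ~ nrm (l - t) <= rho.
  move=> n; apply: contrapT => /forallNP none; apply: far.
  exists n.+1%:R^-1; first by rewrite invr_gt0.
  move=> e /andP[e0 en] l /(Spec_eps_lower_bound A x0N0 cU l (addr_ge0 eps0 e0)) hl.
  apply: contrapT => far; apply: (none l); split.
    by apply: le_trans hl _; rewrite lerD2l.
  by move=> t ht lt; apply: far; exists t.
have zM n : nrm (z n) <= eps + 1 + nrm A.
  rewrite -lerBlDr; apply: le_trans (lower_bound_far A x0N0 (z n)) _.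
  by apply: le_trans (hz n).1 _; rewrite lerD2l invf_le1// ler1n.
have [w hw] := bounded_cluster zM.
have [n _ zw] := hw rho 0%N rho0.
apply: ((hz n).2 w) => //; apply/(Spec_eps_lower_bound A x0N0 cU w eps0).
apply/ler_addgt0Pr => e e0; have e20 : 0 < e / 2 by rewrite divr_gt0.
have [N hN] := exists_invS_le e20.
have [p Np zp] := hw _ N e20.
have := lower_bound_lipschitz A x0N0 w (z p); rewrite lerBlDr => /le_trans; apply.
rewrite [e]splitr addrA lerD//; last by rewrite nrm_distC.
apply: le_trans (hz p).1 _; rewrite lerD2l; apply: le_trans hN.
by rewrite lef_pV2 ?posrE// ler_nat ltnS.
Qed.

Lemma hausdorff_bounds (S T : set R[i]) rho : 0 <= rho -> T `<=` S -> T !=set0 ->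
  (forall s, S s -> exists2 t, T t & nrm (s - t) <= rho) ->
  (0 <= hausdorff S T <= rho%:E)%E.
Proof.
move=> rho0 TS [t Tt] hST; apply/andP; split.
  rewrite /hausdorff le_max; apply/orP; right.
  apply: (@le_trans _ _ (dist t S)); last by apply: ereal_sup_ubound; exists t.
  by apply: le_ereal_inf_tmp => _ [s _ <-]; rewrite lee_fin nrm_ge0.
rewrite /hausdorff ge_max; apply/andP; split; apply: ge_ereal_sup => _ [s Ss <-].
  have [u Tu hu] := hST s Ss; apply: ge_ereal_inf; exists (nrm (s - u))%:E => //.
  by exists u.
apply: ge_ereal_inf; exists (nrm (s - s))%:E; first by exists s => //; exact: TS.
by rewrite subrr nrm0 lee_fin.
Qed.

Lemma hausdorff_cvg (S : nat -> set R[i]) eps (d : nat -> R) : 0 <= eps ->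
  (forall n, (0 < n)%N -> 0 <= d n) -> d n @[n --> \oo] --> 0 ->
  (forall n, (0 < n)%N -> Spec_eps eps A `<=` S n) ->
  (forall n, (0 < n)%N -> S n `<=` Spec_eps (eps + d n) A) ->
  hausdorff (S n) (Spec_eps eps A) @[n --> \oo] --> (0 : \bar R).
Proof.
move=> eps0 d0 dcvg TS ST.
have ne : Spec_eps eps A !=set0.
  have [l /= hl] := Spec_nonempty A x0N0 cU; exists l.
  apply/(Spec_eps_lower_bound A x0N0 cU l eps0); apply: le_trans eps0.
  apply/(Spec_eps_lower_bound A x0N0 cU l (lexx 0)); by rewrite /Spec_eps eqxx.
have bnd rho : 0 < rho -> \forall n \near \oo,
    (0 <= hausdorff (S n) (Spec_eps eps A) <= rho%:E)%E.
  move=> rho0; have [e e0 he] := Spec_eps_upper_semicontinuous eps0 rho0.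
  move/cvgrPdist_le : dcvg => /(_ _ e0)[N _ hN].
  (* Starting at [N + 1] excludes [n = 0], for which nothing is assumed about [S n]. *)
  exists N.+1 => // n /= Nn; have n0 : (0 < n)%N by exact: leq_trans Nn.
  apply: hausdorff_bounds ne _; [exact: ltW|exact: TS|move=> s /(ST n n0)].
  apply: he; rewrite d0//=; have := hN n (ltnW Nn).
  by rewrite /= sub0r normrN ger0_norm// d0.
apply/fine_cvgP; split.
  have := bnd 1 ltr01; apply: filterS => n /andP[h0 h1].
  by rewrite ge0_fin_numE// (le_lt_trans h1)// ltry.
apply/cvgrPdist_le => rho rho0; have := bnd rho rho0; apply: filterS => n /andP[h0 h1] /=.
rewrite sub0r normrN ger0_norm ?fine_ge0// -lee_fin fineK//.
by rewrite ge0_fin_numE// (le_lt_trans h1)// ltry.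
Qed.

End HausdorffConvergence.

Section Penalty.
Variable R : realType.

Lemma cvg_invn : (n%:R^-1 : R) @[n --> \oo] --> (0 : R).
Proof. by rewrite -(cvg_shiftS (fun n => n%:R^-1 : R)); exact: cvg_harmonic. Qed.

Lemma cvg_eps_pp (X : normedModType R[i]) (a : int -> int -> bop X X) :
  eps_pp a n @[n --> \oo] --> (0 : R).
Proof.
rewrite /eps_pp -[X in _ --> X](mulr0 (2 * (alpha_inf a + gamma_inf a))).
apply: cvgM; first exact: cvg_cst.
have h : (pi / (2 * n.+1%:R) : R) @[n --> \oo] --> (0 : R).
  rewrite -[X in _ --> X](mulr0 (pi / 2)).
  rewrite (_ : (fun n => _) = (fun n => pi / 2 * @harmonic R n)); last first.
    by apply/funext => n; rewrite /harmonic invfM mulrA.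
  by apply: cvgM; [exact: cvg_cst|exact: cvg_harmonic].
by have := cvg_comp _ _ h (@continuous_sin R 0); rewrite sin0.
Qed.

Lemma eps_pp_ge0 (X : normedModType R[i]) A (a : int -> int -> bop X X) n :
  tridiagonal A a -> (0 < n)%N -> 0 <= eps_pp a n.
Proof.
move=> hA n0; rewrite /eps_pp !mulr_ge0 ?addr_ge0//.
- by apply: le_trans (alpha_inf_ge hA 0); exact: nrm_ge0.
- by apply: le_trans (gamma_inf_ge hA 0); exact: nrm_ge0.
- rewrite sin_ge0_pi// divr_ge0 ?pi_ge0 ?mulr_ge0//=.
  by rewrite ler_pdivrMr ?mulr_gt0// ler_peMr ?pi_ge0// -natrM ler1n.
Qed.

End Penalty.

Section MatrixNorms.
Variables (R : realType) (X : normedModType R[i]).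

Lemma nrm_fin_le_sum m (y : ell2 'I_m X) : nrm y <= \sum_(r < m) nrm (y r).
Proof.
have yE : y = \sum_(r < m) ell2_single r (y r).
  apply: ell2_eq => r; rewrite ell2_sumE (bigD1 r)//= eqxx big1 ?addr0// => s sr.
  by case: eqP => // rs; rewrite rs eqxx in sr.
rewrite {1}yE; apply: le_trans (nrm_sum _ _ _) _; apply: ler_sum => r _.
by rewrite nrm_ell2_single.
Qed.

Lemma opnorm_mxact_le m n (M : 'M[bop X X]_(m, n)) d : 0 <= d ->
  (forall r c, nrm (M r c) <= d) -> (opnorm (mxact M) <= (m%:R * (n%:R * d))%:E)%E.
Proof.
move=> d0 hM; apply: ge_ereal_sup => _ [z /= z1 <-]; rewrite lee_fin.
apply: le_trans (nrm_fin_le_sum _) _.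
apply: (@le_trans _ _ (\sum_(r < m) n%:R * d)); last first.
  by rewrite sumr_const card_ord -[leLHS]mulr_natl.
apply: ler_sum => r _ /=; apply: le_trans (nrm_sum _ _ _) _.
apply: (@le_trans _ _ (\sum_(c < n) d)); last by rewrite sumr_const card_ord -[leLHS]mulr_natl.
apply: ler_sum => c _; apply: le_trans (nrm_bop_le _ _) _.
rewrite -[d]mulr1 ler_pM ?nrm_ge0//.
by apply: le_trans z1; exact: ell2_coord_le.
Qed.

End MatrixNorms.

(** * Finite covers from relative compactness *)

Section Covers.
Variables (R : realType) (X : normedModType R[i]).

(** The net comes with a choice of net point for every [t], valued in a finite type, so that whole
    windows can be classified by finite functions. *)
Lemma compact_finite_net (V : normedModType R[i]) (T : Type) (f : T -> V) (d : R) :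
  0 < d -> compact (closure (range f)) ->
  exists (D : {fset V}) (g : T -> D), forall t, nrm (f t - val (g t)) <= d.
Proof.
move=> d0; rewrite compact_cover => cf.
have dC : 0 < d%:C :> R[i] by rewrite ltcR.
have [||D _ hD] := cf V setT (fun c => ball c d%:C).
- by move=> c _; exact: ball_open.
- by move=> v _; exists v => //; exact: ballxx.
suff /choice[g hg] : forall t, exists c : D, nrm (f t - val c) <= d by exists D, g.
move=> t; have [c /= cD] := hD (f t) (subset_closure (imageP f I)).
rewrite -ball_normE /ball_/= Defs.normrE ltcR => hc.
by exists [` cD]%fset; rewrite /= nrm_distC ltW.
Qed.

Variable a : int -> int -> bop X X.

(** Pigeonhole: [Phi k] records the net points of all entries of both sections at [k]. It takes
    finitely many values, and one representative of each value suffices. *)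
Lemma covers_exists n : (0 < n)%N ->
  compact (closure (range (fun ij : int * int => a ij.1 ij.2))) ->
  exists K : {fset int}, covers a n K.
Proof.
(* [c] is the number of entries of a section; entrywise errors of at most [n^-1 / c] add up to
   [1 / n], and the net radius is half of that because two entries are compared through a net
   point. *)
move=> n0 ca; pose c : R := n.+2%:R * n%:R.
have c0 : 0 < c by rewrite mulr_gt0 ?ltr0n.
have nV : 0 < n%:R^-1 :> R by rewrite invr_gt0 ltr0n.
have d0 : 0 < n%:R^-1 / c / 2 by rewrite !divr_gt0.
have [D [g hg]] := compact_finite_net d0 ca.
(* The second component has row and column exchanged, as the entries of [adjmx a] are adjoints of
   transposed entries. *)
pose Phi (k : int) : {ffun 'I_n.+2 * 'I_n -> D * D} :=
  [ffun rc : 'I_n.+2 * 'I_n => (g (k + rc.1%:Z, k + 1 + rc.2%:Z), g (k + 1 + rc.2%:Z, k + rc.1%:Z))].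
(* The default 0 is taken only for patterns that no window realises; an extra element of [K] does no
   harm. *)
have /choice[rep hrep] : forall p, exists j : int, (exists k, Phi k = p) -> Phi j = p.
  move=> p; have [[k kp]|np] := pselect (exists k, Phi k = p); first by exists k.
  by exists 0 => /np.
exists [fset rep p | p in {: {ffun 'I_n.+2 * 'I_n -> D * D}}]%fset => k.
exists (rep (Phi k)); first by apply/imfsetP; exists (Phi k).
have e : Phi (rep (Phi k)) = Phi k by apply: hrep; exists k.
have close (t s : int * int) : g t = g s -> nrm (a t.1 t.2 - a s.1 s.2) <= n%:R^-1 / c.
  move=> gts; apply: le_trans (nrm_triangle (val (g t)) _ _) _.
  rewrite [leRHS]splitr; apply: lerD; first exact: (hg t).
  by rewrite nrm_distC gts; exact: (hg s).
have cE : n.+2%:R * (n%:R * (n%:R^-1 / c)) = n%:R^-1 by rewrite mulrA mulrC divfK// gt_eqF.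
have dc0 : 0 <= n%:R^-1 / c by rewrite ltW// divr_gt0.
split; rewrite -cE; apply: opnorm_mxact_le => // r s; rewrite !mxE.
  have /(congr1 fst) := congr1 (fun p : {ffun _} => p (r, s)) e.
  by rewrite !ffunE/= => ge; exact: (close _ _ (esym ge)).
rewrite /adjmx -adjointB; apply: le_trans (nrm_adjoint _) _.
have /(congr1 snd) := congr1 (fun p : {ffun _} => p (r, s)) e.
by rewrite !ffunE/= => ge; exact: (close _ _ (esym ge)).
Qed.

End Covers.

Theorem theorem1p9 (R : realType) (X : completeNormedModType R[i])
    (hX : finite_dim X \/ hilbertian X)
    (A : bop (ell2 int X) (ell2 int X)) (a : int -> int -> bop X X)
    (hA : tridiagonal A a)
    (ha : compact (closure (range (fun ij : int * int => a ij.1 ij.2)))) :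
  (forall n : nat, (0 < n)%N -> exists K : {fset int}, covers a n K) /\
  (forall K : nat -> {fset int},
    (forall n : nat, (0 < n)%N -> covers a n (K n)) ->
    [/\ forall (eps : R) (n : nat), 0 <= eps -> (0 < n)%N ->
          Gamma_fin n (K n) eps A `<=` Spec_eps eps A /\
          Spec_eps eps A `<=` Gamma_fin n (K n) (eps + eps_pp a n + n%:R^-1) A,
        forall (n : nat) (l : R[i]), (0 < n)%N ->
          mu_fin n (K n) (A - l *: bop_id _) =
          \big[mine/+oo%E]_(k <- K n)
            mine (lower_norm setT (mxact (plusmx a n k - scaled_Iplus X n l)))
                 (lower_norm setT (mxact (plusmx (adjmx a) n k
                                          - scaled_Iplus (dual X) n l))),
        (exists x : X, x != 0) -> forall eps : R, 0 <= eps ->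
          hausdorff (Gamma_fin n (K n) (eps + eps_pp a n + n%:R^-1) A)
            (Spec_eps eps A) @[n --> \oo] --> (0 : \bar R)
      & (exists x : X, x != 0) ->
          hausdorff (Gamma_fin n (K n) (eps_pp a n + n%:R^-1) A)
            (Spec A) @[n --> \oo] --> (0 : \bar R)]).
Proof.
split=> [n n0|K hK]; first exact: covers_exists ha.
have cX := @nrm_complete_completeNormedMod R X.
have incl n eps : 0 <= eps -> (0 < n)%N ->
    Spec_eps eps A `<=` Gamma_fin n (K n) (eps + eps_pp a n + n%:R^-1) A.
  by move=> eps0 n0; apply: (Spec_eps_subset_Gamma_fin hA cX eps0 n0); exact: hK.
have cvg (x : X) : x != 0 -> forall eps : R, 0 <= eps ->
    hausdorff (Gamma_fin n (K n) (eps + eps_pp a n + n%:R^-1) A)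
      (Spec_eps eps A) @[n --> \oo] --> (0 : \bar R).
  move=> x_neq0 eps eps0.
  have x0N0 : ell2_single (0 : int) x != 0 by rewrite -nrm_gt0 nrm_ell2_single nrm_gt0.
  have d0 n : (0 < n)%N -> 0 <= eps_pp a n + n%:R^-1.
    by move=> n0; rewrite addr_ge0 ?(eps_pp_ge0 hA n0) ?invr_ge0.
  apply: (hausdorff_cvg x0N0 (ell2_complete cX) eps0 d0).
  - by rewrite -[X in _ --> X](addr0 (0 : R)); apply: cvgD; [exact: cvg_eps_pp|exact: cvg_invn].
  - by move=> n n0; exact: incl.
  - move=> n n0; rewrite -addrA; apply: (Gamma_fin_subset_Spec_eps cX).
    by rewrite addr_ge0 ?d0.
split.
- by move=> eps n eps0 n0; split; [exact: (Gamma_fin_subset_Spec_eps cX)|exact: incl].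
- by move=> n l _; exact: mu_fin_plusmx.
- by move=> [x x_neq0]; exact: cvg x_neq0.
- move=> [x x_neq0]; have := cvg x x_neq0 0 (lexx 0).
  by rewrite /Spec_eps eqxx; under eq_fun do rewrite add0r.
Qed.
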